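(* Let $n\ge 2$ and $k\ge 0$ be integers. A hypersurface of degree $k+1$ in $\mathbb{P}^n$ is a Poncelet hypersurface if and only if it contains (as a closed subscheme) a Poncelet variety of codimension $2$ defined by $n-1$ linearly independent sections of the Schwarzenberger bundle $E_{n,n+k}$.
   Context: Work over $\mathbb{C}$. Let $V$ be a complex vector space of dimension $2$ and $S_i=\mathrm{Sym}^i(V)$, viewed as the space of binary forms of degree $i$ (so $\dim S_i=i+1$). Let $\mathbb{P}(S_n^\vee)\cong\mathbb{P}^n$ denote the projective space whose points are the lines $[h]$ in $S_n$, so that its linear forms are the elements of $S_n^\vee$. For integers $n\ge 1$, $k\ge 0$, multiplication of binary forms $S_k\otimes S_n\to S_{n+k}$ defines the Schwarzenberger bundle $E_{n,n+k}$, of rank $n$ on $\mathbb{P}(S_n^\vee)$, by the exact sequence $$0\to S_k\otimes\mathcal{O}_{\mathbb{P}(S_n^\vee)}(-1)\to S_{n+k}\otimes\mathcal{O}_{\mathbb{P}(S_n^\vee)}\to E_{n,n+k}\to 0,$$ where at the point $[h]$ the first map is $g\mapsto gh$. One has $H^0(E_{n,n+k})\cong S_{n+k}$, so binary forms of degree $n+k$ are sections of $E_{n,n+k}$. For $1\le r\le n$ and linearly independent sections $f_1,\dots,f_r\in S_{n+k}$ of $E_{n,n+k}$, the Poncelet variety defined by them is the closed subscheme of $\mathbb{P}(S_n^\vee)$ with equation $f_1\wedge\cdots\wedge f_r=0$ (vanishing of this section of $\bigwedge^r E_{n,n+k}$). When $r=n$ it is a Poncelet hypersurface of degree $k+1$;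 writing $\Lambda=\langle f_1,\dots,f_n\rangle$, its equation is the determinant of the induced $(k+1)\times(k+1)$ matrix of linear forms $S_k\otimes\mathcal{O}(-1)\to (S_{n+k}/\Lambda)\otimes\mathcal{O}$. A subscheme of $\mathbb{P}^n$ is called a Poncelet variety (hypersurface) if it becomes one under some linear isomorphism $\mathbb{P}^n\cong\mathbb{P}(S_n^\vee)$ (equivalently, for some choice of a rational normal curve in $\mathbb{P}^n$). *)

(* Defs.v *)
(* R[i], for R : realType, is the field of complex numbers. *)
From HB Require Import structures.
From mathcomp Require Import all_boot all_order all_algebra all_fingroup.
From mathcomp Require Import complex reals.
From mathcomp Require Import mpoly.

Set Implicit Arguments.
Unset Strict Implicit.
Unset Printing Implicit Defensive.

Import GRing.Theory.
Local Open Scope ring_scope.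
Local Open Scope complex_scope.

Section Subschemes.
Variables (R : realType) (n : nat).
Local Notation C := R[i].
Local Notation S := {mpoly C[n.+1]}.

(* A closed subscheme of P^n, given by a (possibly infinite) family of
   homogeneous equations.  Distinct families may define the same subscheme:
   equality of subschemes is [same_subscheme] below. *)
Record closed_subscheme := ClosedSubscheme {
  equations : S -> Prop;
  equations_homog : forall p, equations p -> exists d, p \is d.-homog
}.

Definition in_ideal (A : S -> Prop) (p : S) : Prop :=
  exists2 s : seq (S * S),
    (forall qa, qa \in s -> A qa.2) & p = \sum_(qa <- s) qa.1 * qa.2.

(* [subscheme Z Y]: Z is contained in Y as a closed subscheme, i.e. the ideal
   sheaf of Y is contained in that of Z.  On the chart X_i != 0, a homogeneous
   p lies in the localized ideal of Z iff some X_i^N * p lies in the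
   homogeneous ideal generated by the equations of Z. *)
Definition subscheme (Z Y : closed_subscheme) : Prop :=
  forall p, equations Y p ->
  forall i : 'I_n.+1, exists N : nat, in_ideal (equations Z) ('X_i ^+ N * p).

Definition same_subscheme (Z Y : closed_subscheme) : Prop :=
  subscheme Z Y /\ subscheme Y Z.

Definition on_subscheme (Z : closed_subscheme) (x : 'rV[C]_n.+1) : Prop :=
  forall p, equations Z p -> p.@[fun i => x 0 i] = 0.

Definition meets (Z : closed_subscheme) (U : {vspace 'rV[C]_n.+1}) : Prop :=
  exists x, [/\ x \in U, x != 0 & on_subscheme Z x].

(* Z has codimension c in P^n (dimension n - c) when some linear subspace
   P(U) of projective dimension c - 1 is disjoint from Z, whereas every linear
   subspace of projective dimension c meets Z.  The empty subscheme has
   codimension n + 1. *)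
Definition has_codim (Z : closed_subscheme) (c : nat) : Prop :=
  (exists2 U : {vspace 'rV[C]_n.+1}, \dim U = c & ~ meets Z U) /\
  (forall U : {vspace 'rV[C]_n.+1}, \dim U = c.+1 -> meets Z U).

Lemma hypersurface_homog (d : nat) (F : S) (homF : F \is d.-homog) :
  forall p, p = F -> exists e, p \is e.-homog.
Proof. by move=> p ->; exists d. Qed.

Definition hypersurface (d : nat) (F : S) (homF : F \is d.-homog) :=
  ClosedSubscheme (hypersurface_homog homF).

End Subschemes.

Section Poncelet.
Variable R : realType.
Local Notation C := R[i].

(* Sym^d(V): binary forms of degree d. *)
Definition form (d : nat) := dhomog 2 C d.

(* The exponent of the monomial x^j y^(d-j). *)
Definition bimon (d j : nat) : 'X_{1..2} :=
  [multinom (if i == ord0 then j else d - j)%N | i < 2].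

Section Bundle.
Variables (n k : nat).
Local Notation S := {mpoly C[n.+1]}.

(* A vector w of polynomials is seen as the S-linear functional on
   Sym^(n+k)(V) (x) S whose value on x^j y^(n+k-j) is w_j. *)
Definition functional (w : 'rV[S]_(n + k).+1) (f : {mpoly C[2]}) : S :=
  \sum_(j < (n + k).+1) f@_(bimon (n + k) j) *: w 0 j.

(* A basis b of Sym^n(V) is a linear isomorphism from P^n to the space of lines
   in Sym^n(V), [x] |-> [sum_i x_i b_i]; in the coordinates X_i of P^n the
   tautological form is h = sum_i X_i b_i.  The bundle E_{n,n+k} is the
   cokernel of g |-> g h, so the sections of the dual of E_{n,n+k}(-d), i.e. of
   E_{n,n+k}^dual(d), are the functionals of degree d on Sym^(n+k)(V) which
   vanish on h g for every g in Sym^k(V). *)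
Definition dual_section (b : n.+1.-tuple (form n)) (d : nat)
    (w : 'rV[S]_(n + k).+1) : Prop :=
  (forall j, w 0 j \is d.-homog) /\
  (forall g : form k,
    \sum_(i < n.+1) 'X_i * functional w (mpoly_of_dhomog (tnth b i) * g) = 0).

Variables (r : nat) (b : n.+1.-tuple (form n)) (f : r.-tuple (form (n + k))).

(* The zero scheme of the section f_1 /\ ... /\ f_r of the r-th exterior power
   of E := E_{n,n+k}: its ideal is the image of the dual of that exterior power
   under evaluation at the section.  As E is locally free this dual is the
   r-th exterior power of the dual of E, and w_1 /\ ... /\ w_r takes the value
   det (w_i(f_j)) on f_1 /\ ... /\ f_r.  On each chart the sections of the dual
   of E come from homogeneous ones by dividing by a power of X_i. *)
Definition wedge_equations (p : S) : Prop :=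
  exists (d : 'I_r -> nat) (w : 'I_r -> 'rV[S]_(n + k).+1),
    (forall i, dual_section b (d i) (w i)) /\
    p = \det (\matrix_(i < r, j < r) functional (w i) (tnth f j)).

Lemma wedge_equations_homog p :
  wedge_equations p -> exists d, p \is d.-homog.
Proof.
case=> d [w [dw ->]]; exists (\sum_(i < r) d i)%N.
rewrite /determinant; apply: rpred_sum => s _.
rewrite -signr_odd mulr_sign.
have prodP : \prod_i (\matrix_(i, j) functional (w i) (tnth f j)) i (s i)
    \is (\sum_(i < r) d i).-homog.
  elim/big_rec2: _ => [|i q e _ homq]; first exact: dhomog1.
  apply: dhomogM => //; rewrite mxE; apply: rpred_sum => j _.
  by apply: dhomogZ; case: (dw i).
by case: ifP => // _; rewrite dhomogN.
Qed.

Definition wedge_zero_scheme := ClosedSubscheme wedge_equations_homog.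

End Bundle.

Definition poncelet_variety (n k r : nat) (Z : closed_subscheme R n) : Prop :=
  exists (b : n.+1.-tuple (form n)) (f : r.-tuple (form (n + k))),
    [/\ basis_of fullv b, free f & same_subscheme Z (wedge_zero_scheme b f)].

Definition poncelet_hypersurface (n : nat) (Z : closed_subscheme R n) : Prop :=
  exists k, poncelet_variety k n Z.

End Poncelet.

(* Main.v *)
Require Import Defs.
From HB Require Import structures.
From mathcomp Require Import all_boot all_order all_algebra all_fingroup.
From mathcomp Require Import complex reals polyXY ring.
From mathcomp Require Import mpoly.

(** A point of P^n is a binary form h of degree n, and f_1 /\ ... /\ f_r
    vanishes at h when some nonzero member of L = <f_1, ..., f_r> is a multiple
    of h.  Forms of degree d are handled as polynomials of degree at most d in
    one variable ([dehom], [homogenize]).  S_d stands for these forms.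

    Equations.  A homogeneous section of the dual of the bundle is a vector w
    of polynomials with H w = 0, where the rows of H are the k + 1 multiples
    h x^i of the tautological form ([shifts], [dual_sectionP]).  When r = n,
    stacking H and the rows f_j gives a square matrix, whose determinant D has
    degree k + 1.  Let A_i be the matrices obtained when H is completed by unit
    rows instead.  Their adjugates show that D and the equations det (w_i(f_j))
    are multiples of each other, up to powers of det A_i ([det_stack_adjr],
    [det_mul_stack]).  As a radical ideal which contains every det A_i contains
    every coordinate of P^n ([radical_coef], [radical_vars]), the zero scheme
    is the hypersurface D = 0 ([wedge_hypersurface]).

    From the hypersurface to the variety.  Drop one of the n sections.
    Expanding the determinants along the corresponding column shows that the
    zero scheme Z of the others lies in the hypersurface, and the only issue is
    the codimension of Z ([wedge_codim2]).  If the form p of degree n - 1 has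
    roots at which the evaluations are injective on L, no multiple of p divides
    a nonzero member of L, so that Z misses the line p S_1.  That Z meets every
    plane is the degeneracy of some matrix in a net of matrices of size
    (k + 1) x (k + 2) ([net_degenerate]), a two-parameter eigenvalue problem.

    From the variety to the hypersurface.  Let F of degree k + 1 contain Z, and
    let p of degree n - 1 be such that Z misses the line p S_1 ([transverse]).
    On this line, the equations D attached to f_1, ..., f_(n-1) and to one more
    section f_0 restrict to all forms of degree k + 1.  Hence G = F - D vanishes
    on the line for some f_0, and G is still in the ideal of Z, locally
    ([poncelet_completion]).  It remains to see that G = 0.

    If q has degree n - 2, then L contains a multiple q f of q, where f is a
    form of degree k + 2.  On the plane q S_2, put
    h = q (1 - s mu) (1 - t mu) with mu = X - c.  The values of a section of
    the dual on the forms q mu^i satisfy a linear recurrence with roots s and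
    t, so the polynomial (s - t) G in s and t is in the ideal of Phi(s) and
    Phi(t), where Phi is f written in the coordinate 1 / mu ([slice_local]).
    Since G has degree at most k + 1 in s and in t, it vanishes on the plane as
    soon as it vanishes on one line q l S_1 for which the linear form l does
    not divide f ([bivariate_vanish], [vanish_on_plane]).  Starting from the
    line p S_1, one can thus replace the linear factors of p one by one by
    arbitrary linear forms ([vanish_exchange]).  As every binary form is a
    product of linear forms, G vanishes everywhere. *)

Set Implicit Arguments.
Unset Strict Implicit.
Unset Printing Implicit Defensive.

Import Order.TTheory GRing.Theory Num.Theory.
Local Open Scope ring_scope.
Local Open Scope complex_scope.

(** * Polynomials and their values *)

Section Morphisms.
Variables (C : comNzRingType) (n : nat).

Lemma mpoly_morph_ext (T : comNzRingType) (f g : {rmorphism {mpoly C[n]} -> T}) :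
  (forall c, f c%:MP = g c%:MP) -> (forall i, f 'X_i = g 'X_i) -> f =1 g.
Proof.
move=> fgC fgX p; rewrite [p]mpolyE !rmorph_sum; apply: eq_bigr => m _.
rewrite -mul_mpolyC !rmorphM /= fgC; congr (_ * _).
rewrite mpolyXE_id !rmorph_prod; apply: eq_bigr => i _.
by rewrite !rmorphXn /= fgX.
Qed.

Lemma size_mmap_homog (T : comNzRingType) (f : {rmorphism C -> T})
    (h : 'I_n -> {poly T}) d (p : {mpoly C[n]}) :
  p \is d.-homog -> (forall i, (size (h i) <= 2)%N) ->
  (size (mmap (polyC \o f) h p) <= d.+1)%N.
Proof.
move=> homp szh; rewrite /mmap big_seq.
apply: (big_ind (fun u : {poly T} => (size u <= d.+1)%N)) => [|u v szu szv|m mp].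
- by rewrite size_poly0.
- by rewrite (leq_trans (size_polyD _ _)) // geq_max szu.
rewrite mul_polyC (leq_trans (size_scale_leq _ _)) //.
have <- : mdeg m = d := dhomogP _ _ _ homp m mp.
rewrite /mmap1 mdegE; apply: (big_ind2 (fun (u : {poly T}) e => (size u <= e.+1)%N)).
- by rewrite size_poly1.
- move=> u e v e' szu szv; apply: leq_trans (size_polyMleq _ _) _.
  by rewrite -subn1 leq_subLR add1n -addnS -addSn; apply: leq_add.
move=> i _; elim: (m i) => [|e IHe]; first by rewrite expr0 size_poly1.
rewrite exprS; apply: leq_trans (size_polyMleq _ _) _.
rewrite -subn1 leq_subLR add1n; exact: (leq_add (szh i) IHe).
Qed.

End Morphisms.

Section Vanishing.
Variable K : numClosedFieldType.

Lemma poly_nonroot (p : {poly K}) : p != 0 -> exists c, p.[c] != 0.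
Proof.
move=> nz_p; have := max_poly_roots (rs := [seq i%:R | i <- iota 0 (size p)]) nz_p.
rewrite size_map size_iota ltnn => h.
have /allPn[c _] : ~~ all (root p) [seq i%:R | i <- iota 0 (size p)].
  apply/negP => /h; rewrite map_inj_uniq ?iota_uniq; first by move/(_ isT).
  by move=> i j /eqP; rewrite eqr_nat => /eqP.
by exists c.
Qed.

Lemma poly_horner_eq0 (p : {poly K}) : (forall x, p.[x] = 0) -> p = 0.
Proof.
move=> p0; apply/eqP; apply: contraT => /poly_nonroot[c].
by rewrite p0 eqxx.
Qed.

Lemma poly_horner_ext (p q e : {poly K}) :
  e != 0 -> (forall x, e.[x] != 0 -> p.[x] = q.[x]) -> p = q.
Proof.
move=> nz_e pq; have /eqP : e * (p - q) = 0.
  apply: poly_horner_eq0 => x; rewrite hornerM !hornerE.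
  by case: (eqVneq e.[x] 0) => [->|/pq ->]; rewrite ?mul0r // subrr mulr0.
by rewrite mulf_eq0 (negPf nz_e) subr_eq0 => /eqP.
Qed.

Lemma digits_inj D n (u v : 'I_n -> nat) :
  (forall i, u i < D)%N -> (forall i, v i < D)%N ->
  (\sum_(i < n) u i * D ^ i = \sum_(i < n) v i * D ^ i)%N -> u =1 v.
Proof.
elim: n u v => [|n IHn] u v ltu ltv; first by move=> _ [].
have E w : (\sum_(i < n.+1) w i * D ^ i =
    (\sum_(i < n) w (lift ord0 i) * D ^ i) * D + w ord0)%N.
  rewrite big_ord_recl expn0 muln1 addnC big_distrl; congr (_ + _)%N.
  by apply: eq_bigr => i _; rewrite /= /bump leq0n add1n expnSr mulnA.
rewrite !E => uv.
have D_gt0 : (0 < D)%N by apply: leq_ltn_trans (ltu ord0).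
have uv0 : u ord0 = v ord0.
  by have := congr1 (modn^~ D) uv; rewrite !modnMDl !modn_small.
have /IHn uvS : (\sum_(i < n) u (lift ord0 i) * D ^ i =
    \sum_(i < n) v (lift ord0 i) * D ^ i)%N.
  by move: uv; rewrite uv0 => /addIn/eqP; rewrite eqn_pmul2r // => /eqP.
by move=> i; case: (unliftP ord0 i) => [j|] -> //; apply: uvS.
Qed.

(** Kronecker substitution X_i |-> t^(D^i), where D exceeds every exponent
    of p, sends distinct monomials of p to distinct powers of t. *)
Lemma mpoly_vanish n (p : {mpoly K[n]}) : (forall v, p.@[v] = 0) -> p = 0.
Proof.
move=> p0; pose D := msize p.
pose h (i : 'I_n) : {poly K} := 'X^(D ^ i).
pose code (m : 'X_{1..n}) := (\sum_(i < n) m i * D ^ i)%N.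
have hE m : mmap1 h m = 'X^(code m).
  rewrite /mmap1 /code -prodrXr; apply: eq_bigr => i _.
  by rewrite /h -exprM mulnC.
have : mmap polyC h p = 0.
  apply: poly_horner_eq0 => t; rewrite -(p0 (fun i => t ^+ (D ^ i))).
  rewrite -horner_evalE.
  apply: (mpoly_morph_ext (f := horner_eval t \o mmap (@polyC K) h)
    (g := meval (fun i => t ^+ (D ^ i)))) => [c|i] /=.
    by rewrite mmapC mevalC horner_evalE hornerC.
  by rewrite mmapX mmap1U mevalXU horner_evalE hornerXn.
move=> hp0; apply/mpolyP => m; rewrite mcoeff0.
case: (boolP (m \in msupp p)) => [mp|/memN_msupp_eq0 //].
have lt_deg m' i : m' \in msupp p -> (m' i < D)%N.
  move=> /msize_mdeg_lt; apply: leq_ltn_trans.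
  by rewrite mdegE (bigD1 i) //= leq_addr.
have := congr1 (fun q : {poly K} => q`_(code m)) hp0.
rewrite coef0 /mmap coef_sum (bigD1_seq m) ?msupp_uniq //= big_seq_cond big1 ?addr0.
  by rewrite hE coefCM coefXn eqxx mulr1.
move=> m' /andP[m'p ne]; rewrite hE coefCM coefXn; case: eqP; rewrite ?mulr0 // => /digits_inj mm'.
case/eqP: ne; apply/mnmP => i; apply/esym/mm' => j; exact: lt_deg.
Qed.

Lemma mpoly_line n d (p : {mpoly K[n]}) (x y : 'I_n -> K) : p \is d.-homog ->
  exists2 q : {poly K}, (size q <= d.+1)%N &
    forall t, q.[t] = p.@[fun i => x i + t * y i].
Proof.
move=> homp; pose h (i : 'I_n) : {poly K} := (x i)%:P + 'X * (y i)%:P.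
exists (mmap polyC h p) => [|t].
  apply: (@size_mmap_homog _ _ _ idfun _ _ _ homp) => i.
  rewrite (leq_trans (size_polyD _ _)) // geq_max (leq_trans (size_polyC_leq1 _)) //=.
  by rewrite mulrC mul_polyC (leq_trans (size_scale_leq _ _)) // size_polyX.
rewrite -horner_evalE.
apply: (mpoly_morph_ext (f := horner_eval t \o mmap (@polyC K) h)
  (g := meval (fun i => x i + t * y i))) => [c|i] /=.
  by rewrite mmapC mevalC horner_evalE hornerC.
by rewrite mmapX mmap1U mevalXU horner_evalE hornerD hornerM hornerX !hornerC.
Qed.

End Vanishing.

Lemma meval_homog (C : comNzRingType) n d (p : {mpoly C[n]}) (z : C) (x : 'I_n -> C) :
  p \is d.-homog -> p.@[fun i => z * x i] = z ^+ d * p.@[x].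
Proof.
move=> homp; rewrite !mevalE mulr_sumr; apply: eq_big_seq => l lp.
rewrite mulrCA; congr (_ * _).
have <- : mdeg l = d := dhomogP _ _ _ homp l lp.
rewrite mdegE -prodrXr -big_split; apply: eq_bigr => i _.
by rewrite exprMn.
Qed.

(** * Nets of matrices *)

Section Pencils.
Variable K : numClosedFieldType.

Section Controllability.
Variable b : nat.

(** The controllability matrix of control theory, with columns
    y, X y, ..., X^b y. *)
Definition controllability_mx (S : comNzRingType) (X : 'M[S]_b.+1) (y : 'cV[S]_b.+1) :=
  \matrix_(i < b.+1, j < b.+1) (X ^+ j *m y) i 0.

Lemma map_controllability_mx (S T : comNzRingType) (h : {rmorphism S -> T})
    (X : 'M[S]_b.+1) y :
  map_mx h (controllability_mx X y) = controllability_mx (map_mx h X) (map_mx h y).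
Proof.
apply/matrixP => i j; rewrite mxE [controllability_mx X y i j]mxE [RHS]mxE.
by rewrite -rmorphXn -map_mxM [RHS]mxE.
Qed.

Lemma det_controllability_scale (c : K) (X : 'M_b.+1) (y : 'cV_b.+1) :
  \det (controllability_mx (c *: X) (c *: y)) =
  c ^+ (\sum_(j < b.+1) j.+1) * \det (controllability_mx X y).
Proof.
rewrite -prodrXr mulrC.
have -> : controllability_mx (c *: X) (c *: y) =
    controllability_mx X y *m diag_mx (\row_(j < b.+1) c ^+ j.+1).
  apply/matrixP => i j; rewrite mul_mx_diag [LHS]mxE [RHS]mxE exprZn.
  rewrite -scalemxAl -scalemxAr scalerA -exprSr [LHS]mxE mulrC.
  by rewrite [controllability_mx X y i j]mxE [X in _ = _ * X]mxE.
rewrite det_mulmx det_diag; congr (_ * _).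
by apply: eq_bigr => j _; rewrite mxE.
Qed.

(** If v is a nonzero row killed by the controllability matrix, all the rows
    v P(X) with P of degree at most b are killed by y.  Multiply v successively
    by the factors X - z of the characteristic polynomial, until the product
    becomes zero: the last nonzero product is an eigenvector of X. *)
Lemma uncontrollable_eigenvector (X : 'M[K]_b.+1) y :
  \det (controllability_mx X y) = 0 ->
  exists (g : 'rV_b.+1) lambda, [/\ g != 0, g *m X = lambda *: g & g *m y = 0].
Proof.
move=> /eqP/det0P[v nz_v vC].
have vXy j : (j < b.+1)%N -> v *m X ^+ j *m y = 0.
  move=> lt_j; apply/matrixP => i l; rewrite !ord1 -mulmxA.
  transitivity ((v *m controllability_mx X y) 0 (Ordinal lt_j)); last by rewrite vC !mxE.
  by rewrite [LHS]mxE [RHS]mxE; apply: eq_bigr => e _; rewrite [controllability_mx X y e _]mxE.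
have [rs def_rs] := closed_field_poly_normal (char_poly X).
rewrite (monicP (char_poly_monic X)) scale1r in def_rs.
have sz_rs : size rs = b.+1.
  by apply: succn_inj; rewrite -(size_char_poly X) def_rs size_prod_XsubC.
have: v *m horner_mx X (\prod_(z <- rs) ('X - z%:P)) = 0.
  by rewrite -def_rs Cayley_Hamilton mulmx0.
have {}vXy j : (j < size rs)%N -> v *m X ^+ j *m y = 0.
  by rewrite sz_rs; apply: vXy.
clear def_rs sz_rs vC; move: vXy; elim: rs v nz_v => [|z s IHs] v nz_v vXy /=.
  by rewrite big_nil rmorph1 mulmx1 => v0; rewrite v0 eqxx in nz_v.
rewrite big_cons rmorphM /= mulmxA => vrs.
case: (eqVneq (v *m horner_mx X ('X - z%:P)) 0) => [v0|nz_w].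
  exists v, z; split=> //.
    move: v0; rewrite rmorphB /= horner_mx_X horner_mx_C mulmxBr mul_mx_scalar.
    by move/eqP; rewrite subr_eq0 => /eqP.
  by have := vXy 0 isT; rewrite expr0 mulmx1.
apply: (IHs _ nz_w) vrs => j ltj.
rewrite rmorphB /= horner_mx_X horner_mx_C mulmxBr mul_mx_scalar !mulmxBl.
rewrite -!scalemxAl vXy ?(ltn_trans ltj) // scaler0 subr0.
by rewrite -(mulmxA v) [X *m _](_ : _ = X ^+ j.+1) ?vXy // exprS.
Qed.

(** The determinant of the controllability matrix of
    (u A + t N, u a + t n) is homogeneous in (u, t), of positive degree
    D = 1 + 2 + ... + (b + 1), hence it has a nontrivial zero. *)
Lemma pencil_eigenvector (A N : 'M[K]_b.+1) (a n : 'cV_b.+1) :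
  exists u t (g : 'rV_b.+1) lambda, [/\ (u != 0) || (t != 0), g != 0,
    g *m (u *: A + t *: N) = lambda *: g & g *m (u *: a + t *: n) = 0].
Proof.
case: (eqVneq (\det (controllability_mx A a)) 0) => [/uncontrollable_eigenvector|nz_Aa].
  move=> [g [l [nz_g gA ga]]]; exists 1, 0, g, l.
  by rewrite !scale1r !scale0r !addr0 oner_eq0.
pose P (A N : 'M[K]_b.+1) (a n : 'cV_b.+1) :=
  \det (controllability_mx (map_mx polyC A + 'X *: map_mx polyC N)
             (map_mx polyC a + 'X *: map_mx polyC n)).
have PE A' N' a' n' t : (P A' N' a' n').[t] =
    \det (controllability_mx (A' + t *: N') (a' + t *: n')).
  rewrite -horner_evalE -det_map_mx map_controllability_mx; congr (\det (controllability_mx _ _)).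
    by apply/matrixP => i j; rewrite !mxE /= /horner_eval !hornerE.
  by apply/matrixP => i j; rewrite !mxE /= /horner_eval !hornerE.
case: (eqVneq (size (P N A n a)) 1%N) => [/eqP/size_poly1P[c _ def_c]|]; last first.
  move=> /closed_rootP[u /rootP]; rewrite PE.
  move=> /uncontrollable_eigenvector[g [l [nz_g gA ga]]].
  by exists u, 1, g, l; rewrite !scale1r oner_eq0 orbT ![u *: _ + _]addrC.
(* Otherwise the determinant at t = 1 is a constant c; by homogeneity it is
   c t^D at u = 1, which contradicts its value at t = 0. *)
pose D := (\sum_(j < b.+1) j.+1)%N.
have /(congr1 (horner^~ 0)) : P A N a n = c *: 'X^D.
  apply: (@poly_horner_ext _ _ _ 'X); rewrite ?polyX_eq0 // => t.
  rewrite hornerX => nz_t; rewrite PE.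
  have -> : A + t *: N = t *: (N + t^-1 *: A).
    by rewrite scalerDr scalerA divff // scale1r addrC.
  have -> : a + t *: n = t *: (n + t^-1 *: a).
    by rewrite scalerDr scalerA divff // scale1r addrC.
  by rewrite det_controllability_scale -PE def_c !hornerE mulrC.
rewrite PE !scale0r !addr0 !hornerE /D big_ord_recl /= addSn expr0n /= mulr0.
by move=> Aa0; rewrite Aa0 eqxx in nz_Aa.
Qed.

End Controllability.

(** When M0 is injective, it can be normalized to (1 | 0).  The equation on g
    then says that g is an eigenvector of the square part of s1 M1 + s2 M2,
    with eigenvalue - s0, and that the last column of s1 M1 + s2 M2 kills g:
    this is [pencil_eigenvector]. *)
Lemma net_degenerate (b c : nat) (M0 M1 M2 : 'M[K]_(b, c)) :
  (0 < b)%N -> (c <= b.+1)%N ->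
  exists s0 s1 s2 (g : 'rV_b),
    [/\ [|| s0 != 0, s1 != 0 | s2 != 0], g != 0 &
        g *m (s0 *: M0 + s1 *: M1 + s2 *: M2) = 0].
Proof.
case: b M0 M1 M2 => // b M0 M1 M2 _ le_cb.
case: (boolP (row_free M0)) => [|nfree]; last first.
  have /rowV0Pn[g] : kermx M0 != 0 by rewrite kermx_eq0.
  move=> /sub_kermxP gM nz_g; exists 1, 0, 0, g.
  by rewrite oner_eq0 !scale0r !addr0 scale1r.
move=> free0.
pose P := invmx (col_ebase M0); pose Q := invmx (row_ebase M0).
have uP : P \in unitmx by rewrite unitmx_inv col_ebase_unit.
have uQ : Q \in unitmx by rewrite unitmx_inv row_ebase_unit.
have M0E : P *m M0 *m Q = pid_mx (\rank M0).
  rewrite -[X in P *m X](mulmx_ebase M0) /P /Q !mulmxA.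
  by rewrite mulVmx ?col_ebase_unit // mul1mx mulmxK ?row_ebase_unit.
rewrite (eqP free0) in M0E.
have le_bc : (b.+1 <= c)%N by rewrite -(eqP free0) rank_leq_col.
(* ex M is the column of the normal form outside of its square part sq M; when
   c is the number of rows there is none, and ex M is 0. *)
pose ex (M : 'M[K]_(b.+1, c)) : 'cV[K]_b.+1 :=
  \col_i (if insub b.+1 is Some j then (P *m M *m Q) i j else 0).
pose sq (M : 'M[K]_(b.+1, c)) : 'M[K]_b.+1 :=
  \matrix_(i, j) (P *m M *m Q) i (widen_ord le_bc j).
have [u [t [g [l [nz_ut nz_g gsq gex]]]]] :=
  pencil_eigenvector (sq M2) (sq M1) (ex M2) (ex M1).
exists (- l), t, u, (g *m P); split.
- by case/orP: nz_ut => ->; rewrite !orbT.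
- by apply: contraNneq nz_g => gP; rewrite -(mulmxK uP g) gP mul0mx.
have inj : injective (fun w : 'rV[K]_c => w *m Q).
  by move=> v w /(congr1 (mulmxr (invmx Q))) /=; rewrite !mulmxK.
apply: inj; rewrite mul0mx.
rewrite -!mulmxA !(mulmxDl, mulmxDr) -!scalemxAl -!scalemxAr.
rewrite ![P *m (_ *m _)]mulmxA M0E.
have gsqj j : (g *m (P *m M2 *m Q)) 0 (widen_ord le_bc j) = (g *m sq M2) 0 j /\
              (g *m (P *m M1 *m Q)) 0 (widen_ord le_bc j) = (g *m sq M1) 0 j.
  by split; rewrite !mxE; apply: eq_bigr => i _; rewrite [in RHS]mxE.
have gexj (j : 'I_c) : ~~ (j < b.+1)%N -> (g *m (P *m M2 *m Q)) 0 j = (g *m ex M2) 0 0 /\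
              (g *m (P *m M1 *m Q)) 0 j = (g *m ex M1) 0 0.
  rewrite -leqNgt => le_bj; have jE : j = b.+1 :> nat.
    by apply/eqP; rewrite eqn_leq le_bj -ltnS (leq_trans (ltn_ord j)).
  have insj : insub b.+1 = Some j :> option 'I_c by rewrite -jE valK.
  by split; rewrite !mxE; apply: eq_bigr => i _; rewrite [in RHS]mxE insj.
have lin3 (A B C : 'rV[K]_c) x y z i :
    (x *: A + y *: B + z *: C) 0 i = x * A 0 i + y * B 0 i + z * C 0 i.
  by rewrite !mxE.
have lin2 m (A B : 'rV[K]_m) x y i :
    (x *: A + y *: B) 0 i = x * A 0 i + y * B 0 i by rewrite !mxE.
apply/matrixP => z j; rewrite {z}ord1 lin3 [RHS]mxE.
have pidE : (g *m pid_mx b.+1) 0 j =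
    if insub (j : nat) is Some i then g 0 i else 0.
  rewrite mxE; case: insubP => [i _ ij|].
    rewrite (bigD1 i) //= big1 ?addr0 => [|e ne]; rewrite mxE.
      by rewrite ij eqxx -ij ltn_ord mulr1.
    by rewrite -ij (inj_eq val_inj) (negPf ne) mulr0.
  rewrite -leqNgt => le_bj; rewrite big1 // => e _; rewrite mxE.
  by case: eqP => [ej|]; rewrite ?mulr0 // ej ltnNge le_bj mulr0.
rewrite pidE; case: insubP => [i lti ij|].
  have -> : j = widen_ord le_bc i by apply: val_inj.
  have [-> ->] := gsqj i; move/matrixP/(_ 0 i): gsq.
  rewrite mulmxDr -!scalemxAr lin2 [(l *: g) 0 i]mxE => e.
  by rewrite -addrA [t * _ + _]addrC e mulNr addNr.
move=> /gexj[-> ->]; move/matrixP/(_ 0 0): gex.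
by rewrite mulmxDr -!scalemxAr mulr0 add0r lin2 addrC => ->; rewrite mxE.
Qed.

End Pencils.

(** * Determinants of stacked matrices *)

Section RadicalIdeals.
Variable S : comNzRingType.

Record radical_ideal (I : S -> Prop) : Prop := RadicalIdeal {
  radical0 : I 0;
  radicalD : forall p q, I p -> I q -> I (p + q);
  radicalM : forall q p, I p -> I (q * p);
  radicalX : forall p m, I (p ^+ m) -> I p
}.

Lemma radical_sum I (radI : radical_ideal I) (T : Type) (s : seq T) F :
  (forall t, I (F t)) -> I (\sum_(t <- s) F t).
Proof. by move=> IF; apply: big_ind => //; [case: radI|case: radI]. Qed.

Lemma det_congr I (radI : radical_ideal I) m (A A' : 'M[S]_m) :
  (forall i j, I (A i j - A' i j)) -> I (\det A - \det A').
Proof.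
case: radI => I0 ID IM _ IA; rewrite /determinant.
apply: (big_ind2 (fun x y => I (x - y))) => [|x1 x2 y1 y2 ? ?|s _].
- by rewrite subrr.
- by rewrite opprD addrACA; apply: (ID).
rewrite -mulrBr; apply: (IM).
apply: (big_ind2 (fun x y => I (x - y))) => [|x1 x2 y1 y2 ? ?|i _ //].
  by rewrite subrr.
rewrite (_ : _ - _ = x1 * (y1 - y2) + y2 * (x1 - x2)); first by apply: (ID); apply: (IM).
by rewrite !mulrBr [y2 * x1]mulrC [y2 * x2]mulrC addrA subrK.
Qed.

End RadicalIdeals.

(** A column block matrix cast to a square one: for the sizes at stake,
    k + 1 rows h x^i and n sections, the equality with the number n + k + 1 of
    coefficients is not a conversion. *)
Definition stack (S : comNzRingType) (a r m : nat) (e : (a + r = m)%N)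
    (H : 'M[S]_(a, m)) (F : 'M[S]_(r, m)) : 'M[S]_m :=
  castmx (e, erefl m) (col_mx H F).

(** The columns of the adjugate of [stack e H E] which are dual to the rows
    of E. *)
Definition adjr (S : comNzRingType) (a r m : nat) (e : (a + r = m)%N)
    (A : 'M[S]_m) : 'M[S]_(m, r) :=
  rsubmx (castmx (erefl m, esym e) (\adj A)).

Section Stack.
Variables (S : comNzRingType) (a r m : nat) (e : (a + r = m)%N).
Implicit Types (H : 'M[S]_(a, m)) (E F : 'M[S]_(r, m)).

Lemma stackEl H F i j : stack e H F (cast_ord e (lshift r i)) j = H i j.
Proof. by rewrite /stack; case: _ / e H F j => H F j; rewrite castmx_id cast_ord_id col_mxEu. Qed.

Lemma stackEr H F i j : stack e H F (cast_ord e (rshift a i)) j = F i j.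
Proof. by rewrite /stack; case: _ / e H F j => H F j; rewrite castmx_id cast_ord_id col_mxEd. Qed.

Lemma adjrE (A : 'M[S]_m) l j :
  adjr e A l j = \adj A l (cast_ord e (rshift a j)).
Proof.
rewrite /adjr; case: _ / e A l j => A l j.
by rewrite castmx_id cast_ord_id mxE.
Qed.

Lemma mul_adjr H E : H *m adjr e (stack e H E) = 0 /\
  E *m adjr e (stack e H E) = (\det (stack e H E))%:M.
Proof.
rewrite /adjr /stack; case: _ / e H E => H E; rewrite !castmx_id.
have := mul_mx_adj (col_mx H E); rewrite -[\adj _]hsubmxK mul_col_row.
rewrite scalar_mx_block => /eq_block_mx[_ h _ f].
by rewrite row_mxKr.
Qed.

(** The product of [stack e H F] by the adjugate of A is block triangular,
    with diagonal blocks det A and F (adjr A). *)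
Lemma det_stack_adjr H E F (A := stack e H E) :
  \det A ^+ m * \det (stack e H F) = \det A ^+ a.+1 * \det (F *m adjr e A).
Proof.
have [h _] := mul_adjr H E; rewrite {}/A.
rewrite /adjr /stack in h *; case: _ / e H E F h => H E F; rewrite !castmx_id.
set A := col_mx H E => h.
have hl : H *m lsubmx (\adj A) = (\det A)%:M.
  have := mul_mx_adj A; rewrite {1}/A -[\adj _]hsubmxK mul_col_row.
  by rewrite scalar_mx_block row_mxKl => /eq_block_mx[].
have := mul_col_row H F (lsubmx (\adj A)) (rsubmx (\adj A)).
rewrite hsubmxK h hl => /(congr1 determinant).
rewrite det_lblock det_mulmx det_scalar => /(congr1 ( *%R (\det A))).
rewrite [\det A * (_ ^+ a * _)]mulrA -exprS => <-.
by rewrite mulrCA -det_mulmx mul_mx_adj det_scalar mulrC.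
Qed.

(** Multiply A W by the adjugate of A. *)
Lemma scale_adjr H E p (W : 'M_(m, p)) : H *m W = 0 ->
  \det (stack e H E) *: W = adjr e (stack e H E) *m (E *m W).
Proof.
rewrite /adjr /stack; case: _ / e H E W => H E W; rewrite !castmx_id => HW.
rewrite -mul_scalar_mx -mul_adj_mx -mulmxA mul_col_mx HW.
by rewrite -{1}[\adj _]hsubmxK mul_row_col mulmx0 add0r.
Qed.

Lemma det_mul_adjr H E F (W : 'M_(m, r)) (A := stack e H E) : H *m W = 0 ->
  \det A ^+ r * \det (F *m W) = \det (F *m adjr e A) * \det (E *m W).
Proof.
by move=> HW; rewrite -det_mulmx -mulmxA -scale_adjr // -scalemxAr detZ.
Qed.

(** The product of [stack e H E] by the matrix (V | E^T) is block triangular,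
    with diagonal blocks H V and 1. *)
Lemma det_stack_unit H E (V : 'M_(m, a)) : E *m V = 0 -> E *m E^T = 1%:M ->
  \det (H *m V) =
  \det (castmx (erefl m, e) (row_mx V E^T)) * \det (stack e H E).
Proof.
rewrite /stack; case: _ / e H E V => H E V EV EE; rewrite !castmx_id.
by rewrite mulrC -det_mulmx mul_col_row EV EE det_ublock det1 mulr1.
Qed.

Lemma det_mul_stack H E F (W : 'M_(m, r)) (A := stack e H E) : H *m W = 0 ->
  \det A ^+ (a.+1 + r) * \det (F *m W) =
  \det A ^+ m * \det (E *m W) * \det (stack e H F).
Proof.
move=> HW; rewrite exprD -mulrA det_mul_adjr // mulrA -det_stack_adjr.
by rewrite -!mulrA [\det (E *m W) * _]mulrC.
Qed.

End Stack.

Lemma map_stack (S T : comNzRingType) (h : {rmorphism S -> T}) a r m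
    (e : (a + r = m)%N) H F :
  map_mx h (stack e H F) = stack e (map_mx h H) (map_mx h F).
Proof. by rewrite /stack map_castmx map_col_mx. Qed.

Lemma map_adjr (S T : comNzRingType) (h : {rmorphism S -> T}) a r m
    (e : (a + r = m)%N) A :
  map_mx h (adjr e A) = adjr e (map_mx h A).
Proof. by rewrite /adjr map_rsubmx map_castmx map_mx_adj. Qed.

Section Shifts.
Variables (S : comNzRingType) (n k m : nat).

(** The matrix of the multiplication by p, from polynomials of degree at most
    k to polynomials of degree less than m. *)
Definition shifts (p : {poly S}) : 'M[S]_(k.+1, m) :=
  \matrix_(i, j) (p * 'X^i)`_j.

Lemma shifts_lin a p q : shifts (a *: p + q) = a *: shifts p + shifts q.
Proof. by apply/matrixP => i j; rewrite !mxE mulrDl -scalerAl coefD coefZ. Qed.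

Lemma shiftsZ a p : shifts (a *: p) = a *: shifts p.
Proof. by apply/matrixP => i j; rewrite !mxE -scalerAl coefZ. Qed.

Lemma mul_shifts p (g : 'rV_k.+1) : g *m shifts p = poly_rV (p * rVpoly g).
Proof.
apply/rowP => j; rewrite !mxE [rVpoly g]poly_def mulr_sumr coef_sum.
by apply: eq_bigr => i _; rewrite mxE valK -scalerAr coefZ.
Qed.

(** Selects the columns i, ..., i + k. *)
Definition window_mx (i : nat) : 'M[S]_(m, k.+1) := \matrix_(l, s) (l == i + s :> nat)%:R.

(** The unit rows with index outside of the window i, ..., i + k. *)
Definition outside_mx (i : nat) : 'M[S]_(n, m) :=
  \matrix_(j, l) (l == (if j < i then j : nat else j + k.+1)%N :> nat)%:R.

Variable e : (k.+1 + n = m)%N.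

(** The k + 1 columns of [shifts p] in the window at i form the Toeplitz
    matrix T with entries p_(i + s - r), whose determinant is in I by
    [det_stack_unit].  Modulo the coefficients p_j with j > i, T is triangular
    and its determinant is the power p_i^(k + 1).  Conclude by descending
    induction on i. *)
Lemma radical_coef (I : S -> Prop) (radI : radical_ideal I) (p : {poly S}) :
  (size p <= n.+1)%N ->
  (forall i, (i <= n)%N -> I (\det (stack e (shifts p) (outside_mx i)))) ->
  forall i, I p`_i.
Proof.
move=> sz_p Idet.
have IN q : I q -> I (- q) by rewrite -mulN1r; apply: radicalM.
suff Ic d i : (n < i + d)%N -> I p`_i by move=> i; apply: (Ic n.+1); rewrite addnS ltnS leq_addl.
elim: d i => [|d IHd] i.
  by rewrite addn0 => ltni; rewrite nth_default ?(leq_trans sz_p) //; case: radI.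
move=> ltn_id; case: (leqP i n) => [le_in|ltni]; last first.
  by rewrite nth_default ?(leq_trans sz_p) //; case: radI.
have Igt j : (i < j)%N -> I p`_j.
  by move=> ltij; apply: IHd; apply: leq_trans ltn_id _; rewrite addnS ltn_add2r.
pose T := shifts p *m window_mx i.
have TE r s : T r s = if (i + s < r)%N then 0 else p`_(i + s - r).
  have ltis : (i + s < m)%N.
    by rewrite -e [(k.+1 + n)%N]addnC -addSn addSnnS leq_add // ltnS -ltnS ltn_ord.
  rewrite !mxE (bigD1 (Ordinal ltis)) //= big1 ?addr0 => [|l ne]; rewrite !mxE.
    by rewrite eqxx mulr1 coefMXn.
  by rewrite (_ : _ == _ = false) ?mulr0 //; apply: contraNF ne => /eqP l_is; apply/eqP/val_inj.
pose L := \matrix_(r, s) (if (s <= r)%N then T r s else 0).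
have detL : \det L = p`_i ^+ k.+1.
  rewrite det_trig; last by apply/is_trig_mxP => r s ltrs; rewrite mxE leqNgt ltrs.
  rewrite -[in RHS](card_ord k.+1) -prodr_const; apply: eq_bigr => r _.
  by rewrite mxE leqnn TE ltnNge leq_addl addnK.
have ITL r s : I (T r s - L r s).
  rewrite [L r s]mxE; case: (leqP s r) => [_|ltrs]; first by rewrite subrr; case: radI.
  rewrite subr0 TE ltnNge (leq_trans (ltnW ltrs)) ?leq_addl //=.
  by apply: Igt; rewrite -addnBA ?(ltnW ltrs) // -[X in (X < _)%N]addn0 ltn_add2l subn_gt0.
have IT : I (\det T).
  have OW : outside_mx i *m window_mx i = 0.
    apply/matrixP => j s; rewrite !mxE big1 // => l _; rewrite !mxE.
    case: eqP => [->|]; rewrite ?mul0r // mul1r.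
    case: ltnP => ji; case: eqP => // /eqP.
      by rewrite ltn_eqF // (leq_trans ji) ?leq_addr.
    by rewrite gtn_eqF // -addnS; apply: leq_add.
  have OO : outside_mx i *m (outside_mx i)^T = 1%:M.
    apply/matrixP => j j'; rewrite !mxE.
    have ltl : ((if j < i then j : nat else j + k.+1) < m)%N.
      rewrite -e; case: ifP => _; last by rewrite addnC ltn_add2l.
      by rewrite (leq_trans (ltn_ord j)) ?leq_addl.
    rewrite (bigD1 (Ordinal ltl)) //= big1 ?addr0 => [|l ne]; rewrite !mxE.
      rewrite eqxx mul1r; congr (nat_of_bool _)%:R; rewrite -val_eqE /=.
      case: ltnP => ji; case: ltnP => j'i //.
      + by rewrite !ltn_eqF // (leq_trans ji) // (leq_trans j'i) ?leq_addr.
      + by rewrite !gtn_eqF // (leq_trans j'i) // (leq_trans ji) ?leq_addr.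
      + by rewrite eqn_add2r.
    by rewrite (_ : _ == _ = false) ?mul0r //; apply: contraNF ne => /eqP l_is; apply/eqP/val_inj.
  rewrite (det_stack_unit e _ OW OO).
  by apply: radicalM => //; apply: Idet.
apply: (radicalX radI (m := k.+1)); rewrite -detL -[\det L](subKr (\det T)).
by apply: radicalD => //; apply: IN; apply: det_congr.
Qed.

End Shifts.

Section StackField.
Variables (K : fieldType) (a r m : nat).

Lemma det_stack_eq0 (e : (a + r = m)%N) (H : 'M[K]_(a, m)) (F : 'M[K]_(r, m)) :
  \det (stack e H F) = 0 <->
  exists (g : 'rV_a) (t : 'rV_r), ((g != 0) || (t != 0)) /\ g *m H + t *m F = 0.
Proof.
rewrite /stack; case: _ / e H F => H F; rewrite castmx_id; split.
  move=> /eqP/det0P[v nz_v vHF]; exists (lsubmx v), (rsubmx v).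
  split; last by rewrite -mul_row_col hsubmxK.
  by rewrite -negb_and -row_mx_eq0 hsubmxK.
move=> [g [t [nz gt0]]]; apply/eqP/det0P; exists (row_mx g t).
  by rewrite row_mx_eq0 negb_and.
by rewrite mul_row_col.
Qed.

Lemma det_stack_cons_eq0 (e : (a + r.+1 = m)%N) (H : 'M[K]_(a, m)) (w : 'rV[K]_m)
    (M : 'M[K]_(r, m)) :
  \det (stack e H (col_mx w M : 'M_(1 + r, m))) = 0 <->
  exists (g : 'rV_a) x (t : 'rV_r), [|| g != 0, x != 0 | t != 0] /\
    g *m H + x *: w + t *m M = 0.
Proof.
rewrite /stack; case: _ / e H w M => H w M; rewrite castmx_id; split.
  move=> /eqP/det0P[v nz_v vHF].
  exists (lsubmx v), (lsubmx (rsubmx v : 'rV_(1 + r)) 0 0), (rsubmx (rsubmx v : 'rV_(1 + r))).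
  rewrite -mul_scalar_mx -mx11_scalar -addrA -mul_row_col hsubmxK -mul_row_col hsubmxK.
  split=> //; apply: contraNT nz_v; rewrite !negb_or !negbK => /and3P[/eqP g0 /eqP x0 /eqP t0].
  rewrite -[v]hsubmxK g0 -[rsubmx v](hsubmxK (rsubmx v : 'rV_(1 + r))) t0.
  by rewrite [lsubmx (_ : 'rV_(1 + r))]mx11_scalar x0 raddf0 !row_mx0.
move=> [g [x [t [nz gxt0]]]]; apply/eqP/det0P.
exists (row_mx g (row_mx x%:M t : 'rV_(1 + r))); last first.
  by rewrite mul_row_col (mul_row_col x%:M) mul_scalar_mx addrA.
apply: contraL nz => /eqP; rewrite -[0](@row_mx0 _ _ a (1 + r)) => /eq_row_mx[-> E].
have /eq_row_mx[x0 ->] : row_mx x%:M t = row_mx 0 0 :> 'rV_(1 + r) by rewrite E row_mx0.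
have -> : x = 0 by have := congr1 (fun N : 'M_1 => N 0 0) x0; rewrite !mxE.
by rewrite !eqxx.
Qed.

Lemma det_stack_linear (e : (a + r.+1 = m)%N) (H : 'M[K]_(a, m)) (M : 'M[K]_(r, m))
    x (w w' : 'rV_m) (delta := fun w : 'rV_m => \det (stack e H (col_mx w M : 'M_(1 + r, m)))) :
  delta (x *: w + w') = x * delta w + delta w'.
Proof.
rewrite /delta {delta} /stack; case: _ / e H M w w' => H M w w'; rewrite !castmx_id.
pose i0 : 'I_(a + (1 + r)) := rshift a (lshift r 0).
have rowE (v : 'rV_(a + r.+1)) : row i0 (col_mx H (col_mx v M)) = v.
  by apply/rowP => j; rewrite mxE col_mxEd col_mxEu.
have row'E (v v' : 'rV_(a + r.+1)) :
    row' i0 (col_mx H (col_mx v M)) = row' i0 (col_mx H (col_mx v' M)).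
  apply/matrixP => i j; rewrite [LHS]mxE [RHS]mxE.
  move: (neq_lift i0 i); case: (split_ordP (lift i0 i)) => i1 -> ne.
    by rewrite !col_mxEu.
  rewrite !col_mxEd; move: ne; case: (split_ordP i1) => i2 -> ne.
    by rewrite [i2]ord1 eqxx in ne.
  by rewrite !col_mxEd.
rewrite -[X in _ = _ + X]mul1r; apply: (determinant_multilinear (i0 := i0)) => //.
by rewrite !rowE scale1r.
Qed.

End StackField.

Section Homogeneity.
Variables (C : idomainType) (n : nat).
Local Notation S := {mpoly C[n]}.

Lemma det_homog p (A : 'M[S]_p) (d : 'I_p -> nat) :
  (forall i j, A i j \is (d i).-homog) -> \det A \is (\sum_i d i).-homog.
Proof.
move=> homA; apply: rpred_sum => s _.
rewrite -signr_odd mulr_sign.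
have homP : \prod_i A i (s i) \is (\sum_i d i).-homog.
  elim/big_rec2: _ => [|i q e _ homq]; first exact: dhomog1.
  exact: dhomogM.
by case: ifP => // _; rewrite dhomogN.
Qed.

Variables (q r m : nat) (e : (q + r = m)%N).
Variables (H : 'M[S]_(q, m)) (F : 'M[S]_(r, m)).
Hypothesis homH : forall i j, H i j \is 1.-homog.
Hypothesis homF : forall i j, F i j \is 0.-homog.

Let deg (i : 'I_m) : nat := (i < q)%N.

Let sum_deg : (\sum_i deg i = q)%N.
Proof.
rewrite /deg; case: _ / e; rewrite big_split_ord /= [X in (_ + X)%N]big1 ?addn0.
  by rewrite -[RHS]card_ord -sum1_card; apply: eq_bigr => i _; rewrite ltn_ord.
by move=> i _; rewrite ltnNge leq_addr.
Qed.

Let homA i j : stack e H F i j \is (deg i).-homog.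
Proof.
rewrite -[ i ](cast_ordKV e); case: (split_ordP (cast_ord (esym e) i)) => l ->.
  by rewrite stackEl /deg /= ltn_ord.
by rewrite stackEr /deg /= ltnNge leq_addr.
Qed.

Lemma det_stack_homog : \det (stack e H F) \is q.-homog.
Proof. by have := det_homog homA; rewrite sum_deg. Qed.

Lemma adjr_homog l j : adjr e (stack e H F) l j \is q.-homog.
Proof.
rewrite adjrE mxE /cofactor -signr_odd mulr_sign.
set i0 := cast_ord _ _.
have hom : \det (row' i0 (col' l (stack e H F))) \is (\sum_i deg (lift i0 i)).-homog.
  by apply: det_homog => i j'; rewrite !mxE.
have degq : (\sum_i deg (lift i0 i))%N = q.
  by rewrite -[RHS]sum_deg (bigD1_ord i0) //= /deg /= ltnNge leq_addr add0n.
by rewrite degq in hom; case: ifP => // _; rewrite dhomogN.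
Qed.

End Homogeneity.

(** * Binary forms as polynomials in one variable *)

Section BinaryForms.
Variable R : realType.
Local Notation C := R[i].
Local Notation form := (Defs.form R).

(** Dehomogenization x |-> X, y |-> 1.  A form of degree d becomes a
    polynomial of degree at most d; the multiplicity of the root at infinity is
    the defect of the degree. *)
Definition dehom : {mpoly C[2]} -> {poly C} :=
  mmap polyC (fun i => if i == ord0 then 'X else 1).

HB.instance Definition _ := GRing.RMorphism.copy dehom
  (mmap (@polyC C) (fun i => if i == ord0 then 'X else 1)).

Lemma dehomZ c f : dehom (c *: f) = c *: dehom f.
Proof. by rewrite /dehom mmapZ mul_polyC. Qed.

Lemma dehomX m : dehom 'X_[m] = 'X^(m ord0).
Proof.
rewrite /dehom mmapX /mmap1 big_ord_recl /= big1 ?mulr1 // => i _.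
by rewrite expr1n.
Qed.

Lemma bimon0 d j : bimon d j ord0 = j. Proof. by rewrite mnmE. Qed.

Lemma mdeg_bimon d j : (j <= d)%N -> mdeg (bimon d j) = d.
Proof. by move=> lejd; rewrite mdegE !big_ord_recl big_ord0 !mnmE /= addn0 subnKC. Qed.

Lemma bimonE d (m : 'X_{1..2}) : mdeg m = d -> m = bimon d (m ord0).
Proof.
rewrite mdegE !big_ord_recl big_ord0 addn0 => <-; apply/mnmP => i; rewrite mnmE.
case: (unliftP ord0 i) => [j|] -> //=; rewrite addKn.
by rewrite [j]ord1.
Qed.

Lemma coef_dehom d (f : form d) j :
  (dehom f)`_j = if (j <= d)%N then (f : {mpoly C[2]})@_(bimon d j) else 0.
Proof.
have hom_f := dhomog_is_dhomog f.
rewrite {1}[mpoly_of_dhomog f]mpolyE rmorph_sum coef_sum /=.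
have E m : m \in msupp f -> (dehom ((f : {mpoly C[2]})@_m *: 'X_[m]))`_j =
    (f : {mpoly C[2]})@_m * (j == m ord0)%:R.
  by move=> _; rewrite dehomZ dehomX coefZ coefXn.
rewrite (eq_big_seq _ E) {E}.
have degm m : m \in msupp f -> m = bimon d (m ord0).
  by move=> mf; apply: bimonE; apply: (dhomogP _ _ _ hom_f).
case: (boolP (bimon d j \in msupp f)) => [bf|nbf]; last first.
  rewrite (_ : (if _ then _ else _) = 0); last by rewrite (memN_msupp_eq0 nbf) if_same.
  rewrite big1_seq // => m /= mf; case: eqP => [jm|_]; rewrite ?mulr0 //.
  by rewrite jm -degm ?mf in nbf.
rewrite (bigD1_seq _ bf) ?msupp_uniq //= bimon0 eqxx mulr1 big1_seq ?addr0.
  case: leqP => // ltdj.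
  have : mdeg (bimon d j) = d := dhomogP _ _ _ hom_f _ bf.
  rewrite mdegE !big_ord_recl big_ord0 !mnmE /= addn0 (eqP (ltnW ltdj)) addn0.
  by move=> jd; rewrite jd ltnn in ltdj.
move=> m /andP[ne mf]; case: eqP => [jm|_]; rewrite ?mulr0 //.
by rewrite jm -degm ?mf ?eqxx in ne.
Qed.

Lemma size_dehom d (f : form d) : (size (dehom f) <= d.+1)%N.
Proof. by apply/leq_sizeP => j ltdj; rewrite coef_dehom leqNgt ltdj. Qed.

Lemma dehom_inj d (f g : form d) : dehom f = dehom g -> f = g.
Proof.
move=> fg; apply/val_inj/mpolyP => m /=.
case: (eqVneq (mdeg m) d) => [dm|nm]; last first.
  by rewrite !(dhomog_nemf_coeff (dhomog_is_dhomog _) nm).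
have le_m : (m ord0 <= d)%N.
  by rewrite -dm mdegE big_ord_recl leq_addr.
have := congr1 (fun p : {poly C} => p`_(m ord0)) fg.
by rewrite !coef_dehom le_m -bimonE.
Qed.

Lemma form_subproof d (p : {poly C}) :
  \sum_(j < d.+1) p`_j *: 'X_[bimon d j] \is d.-homog.
Proof.
apply: rpred_sum => j _; apply: dhomogZ.
by rewrite dhomogX; apply/eqP; apply: mdeg_bimon; rewrite -ltnS.
Qed.

Definition homogenize d (p : {poly C}) : form d := DHomog (form_subproof d p).

Lemma homogenizeK d (p : {poly C}) : (size p <= d.+1)%N -> dehom (homogenize d p) = p.
Proof.
move=> szp; rewrite /= rmorph_sum /=.
rewrite -[RHS](coefK p) poly_def (big_ord_widen _ (fun i => p`_i *: 'X^i) szp).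
rewrite [RHS]big_mkcond; apply: eq_bigr => j _; rewrite dehomZ dehomX bimon0.
by case: ltnP => // le_j; rewrite nth_default // scale0r.
Qed.

End BinaryForms.

Section Freeness.
Variable R : realType.
Local Notation C := R[i].
Local Notation form := (Defs.form R).

Lemma dehom_sum d (I : Type) (s : seq I) (c : I -> C) (f : I -> form d) :
  dehom (\sum_(j <- s) c j *: f j : form d) = \sum_(j <- s) c j *: dehom (f j).
Proof.
rewrite (raddf_sum (@mpoly_of_dhomog _ _ _)) (raddf_sum (@dehom R)).
by apply: eq_bigr => j _ /=; rewrite dehomZ.
Qed.

Lemma free_dehom d r (f : r.-tuple (form d)) :
  free f = row_free (\matrix_(j < r, l < d.+1) (dehom (tnth f j))`_l).
Proof.
set M := \matrix_(_, _) _.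
have E (t : 'rV[C]_r) : (t *m M == 0) = (\sum_(j < r) t 0 j *: tnth f j == 0).
  have tME : t *m M = poly_rV (dehom (\sum_(j < r) t 0 j *: tnth f j : form d)).
    apply/rowP => l; rewrite mxE dehom_sum mxE coef_sum.
    by apply: eq_bigr => j _; rewrite mxE coefZ.
  apply/eqP/eqP => [tM|tf]; last by rewrite tME tf rmorph0 linear0.
  apply: dehom_inj; rewrite -[LHS](poly_rV_K (size_dehom _)) -tME tM.
  by rewrite linear0 rmorph0.
apply/freeP/idP => [freef|freeM k kf i].
  rewrite -kermx_eq0; apply/rowV0P => t /sub_kermxP/eqP; rewrite E => /eqP tf.
  apply/rowP => j; rewrite mxE; apply: freef => //; rewrite -[RHS]tf.
  by apply: eq_bigr => l _; rewrite (tnth_nth 0).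
have /eqP : (\row_j k j) *m M = 0.
  apply/eqP; rewrite E -[X in _ == X]kf; apply/eqP/eq_bigr => l _.
  by rewrite mxE (tnth_nth 0).
by rewrite mulmx_free_eq0 // => /eqP/rowP/(_ i); rewrite !mxE.
Qed.

End Freeness.

(** * Ideals and closed subschemes *)

Section Ideals.
Variables (R : realType) (n : nat).
Local Notation C := R[i].
Local Notation S := {mpoly C[n.+1]}.
Implicit Types (A B : S -> Prop) (p q : S).

Lemma in_ideal0 A : in_ideal A 0.
Proof. by exists [::]; rewrite ?big_nil. Qed.

Lemma in_idealD A p q : in_ideal A p -> in_ideal A q -> in_ideal A (p + q).
Proof.
move=> [s sA ->] [t tA ->]; exists (s ++ t); last by rewrite big_cat.
by move=> qa; rewrite mem_cat => /orP[/sA|/tA].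
Qed.

Lemma in_idealM A p q : in_ideal A p -> in_ideal A (q * p).
Proof.
move=> [s sA ->]; exists [seq (q * qa.1, qa.2) | qa <- s].
  by move=> _ /mapP[qa /sA ? ->].
by rewrite big_map mulr_sumr; apply: eq_bigr => qa _; rewrite mulrA.
Qed.

Lemma in_ideal_gen A p q : A p -> in_ideal A (q * p).
Proof.
move=> Ap; exists [:: (q, p)]; last by rewrite big_seq1.
by move=> qa; rewrite inE => /eqP ->.
Qed.

Lemma in_ideal_sum A (T : Type) (s : seq T) F :
  (forall t, in_ideal A (F t)) -> in_ideal A (\sum_(t <- s) F t).
Proof.
by move=> AF; apply: big_ind => //; [exact: in_ideal0 | exact: in_idealD].
Qed.

(** The radical of the ideal quotient (A : p), which consists of the q such
    that p is in the ideal of A on the open set where q is invertible. *)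
Definition colon_radical A p q := exists N, in_ideal A (q ^+ N * p).

Lemma colon_radical_ideal A p : radical_ideal (colon_radical A p).
Proof.
split=> [|q1 q2 [N1 A1] [N2 A2]|q1 q2 [N A2]|q m [N Aq]].
- by exists 1%N; rewrite expr1 mul0r; apply: in_ideal0.
- exists (N1 + N2)%N; rewrite exprDn mulr_suml; apply: in_ideal_sum => i.
  rewrite mulrnAl -mulrnAr; case: (leqP N2 i) => [le_i|lt_i].
    rewrite -(subnK le_i) exprD -!mulrA; do 2!apply: in_idealM.
    by rewrite -mulr_natl mulrCA; apply: in_idealM.
  have le_i : (N1 <= N1 + N2 - i)%N by rewrite -addnBA ?leq_addr // ltnW.
  rewrite -(subnK le_i) exprD -!mulrA; apply: in_idealM.
  rewrite mulrCA; apply: in_idealM.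
  by rewrite -mulr_natl mulrCA; apply: in_idealM.
- by exists N; rewrite exprMn -mulrA; apply: in_idealM.
by exists (m * N)%N; rewrite exprM.
Qed.

Lemma in_ideal_local A B q p : in_ideal A p ->
  (forall a, A a -> colon_radical B a q) -> colon_radical B p q.
Proof.
move=> [s sA ->] AB; elim: s sA => [|[c a] s IHs] sA.
  by exists 0%N; rewrite big_nil mulr0; apply: in_ideal0.
rewrite big_cons /=.
have [|N1 B1] := IHs; first by move=> qa qas; apply: sA; rewrite inE qas orbT.
have [N2 B2] := AB _ (sA (c, a) (mem_head _ _)).
exists (N1 + N2)%N; rewrite mulrDr; apply: in_idealD.
  by rewrite exprD -mulrA [q ^+ N2 * _]mulrCA; do 2!apply: in_idealM.
by rewrite addnC exprD -mulrA; apply: in_idealM.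
Qed.

Lemma subscheme_refl (Z : closed_subscheme R n) : subscheme Z Z.
Proof. by move=> p Zp i; exists 0%N; apply: in_ideal_gen. Qed.

Lemma subscheme_trans (Z Y X : closed_subscheme R n) :
  subscheme Z Y -> subscheme Y X -> subscheme Z X.
Proof.
move=> ZY YX p Xp i; have [N YN] := YX p Xp i.
have [M ZM] : colon_radical (equations Z) ('X_i ^+ N * p) 'X_i.
  by apply: in_ideal_local YN _ => a Ya; apply: ZY.
by exists (M + N)%N; rewrite exprD -mulrA.
Qed.

Lemma same_subscheme_trans (Z Y X : closed_subscheme R n) :
  same_subscheme Z Y -> same_subscheme Y X -> same_subscheme Z X.
Proof.
move=> [ZY YZ] [YX XY].
by split; [apply: subscheme_trans YX | apply: subscheme_trans YZ].
Qed.

Lemma same_subscheme_sym (Z Y : closed_subscheme R n) :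
  same_subscheme Z Y -> same_subscheme Y Z.
Proof. by case. Qed.

(** In q X_i^N = p X_j^M, all the exponents of X_i are at least N, and X_j^M
    does not contribute to them. *)
Lemma dvd_powX (i j : 'I_n.+1) N M (p q : S) :
  i != j -> p * 'X_j ^+ M = q * 'X_i ^+ N -> exists p', p = p' * 'X_i ^+ N.
Proof.
move=> ne_ij; rewrite !mpolyXn => pq.
pose m0 : 'X_{1..n.+1} := (U_(i) *+ N)%MM.
exists (\sum_(m <- msupp p) p@_m *: 'X_[m - m0]).
rewrite {1}[p]mpolyE mulr_suml; apply: eq_big_seq => m mp.
rewrite -scalerAl -mpolyXD submK //; apply/mnm_lepP => l.
rewrite mulmnE mnm1E; case: eqP => [<-{l}|_]; last by rewrite mul0n.
have : (U_(j) *+ M + m)%MM \in msupp (q * 'X_[m0]).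
  by rewrite -pq mcoeff_msupp mcoeffMX -mcoeff_msupp.
rewrite (perm_mem (msuppMX _ _)) => /mapP[m' _ mm'].
have := congr1 (fun v : 'X_{1..n.+1} => v i) mm'.
rewrite !mnmDE !mulmnE !mnm1E eqxx [j == i]eq_sym (negPf ne_ij) mul1n add0n => ->.
exact: leq_addr.
Qed.

(** F divides the product of G by a power of the first variable and by a
    power of the last one, and these powers are coprime. *)
Lemma dvd_hypersurface d e (F G : S) (homF : F \is d.-homog) (homG : G \is e.-homog) :
  (0 < n)%N -> subscheme (hypersurface homF) (hypersurface homG) ->
  exists q, G = q * F.
Proof.
move=> n_gt0 FG.
have XG i : exists N c, 'X_i ^+ N * G = c * F.
  have [N [s sF sE]] := FG G erefl i; exists N, (\sum_(qa <- s) qa.1).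
  by rewrite sE mulr_suml; apply: eq_big_seq => qa /sF /= ->.
have [N [a aE]] := XG ord0; have [M [b bE]] := XG ord_max.
have nzX i m : 'X_i ^+ m != 0 :> S.
  apply/expf_neq0/eqP => /(congr1 (mcoeff U_(i))) /eqP.
  by rewrite mcoeffXU eqxx mcoeff0 oner_eq0.
case: (eqVneq F 0) => [F0|nz_F].
  exists 0; move: aE; rewrite F0 !mulr0 => /eqP.
  by rewrite mulf_eq0 (negPf (nzX _ _)) => /eqP.
have ne : ord0 != ord_max :> 'I_n.+1 by rewrite -val_eqE /= ltn_eqF.
have ab : a * 'X_ord_max ^+ M = b * 'X_ord0 ^+ N.
  by apply: (mulIf nz_F); rewrite mulrAC -aE [RHS]mulrAC -bE mulrC -[RHS]mulrA [G * _]mulrC.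
have [a' def_a] := dvd_powX ne ab.
exists a'; apply: (mulfI (nzX ord0 N)); rewrite aE def_a.
by rewrite mulrAC mulrC.
Qed.

End Ideals.

(** * Sections of the dual of the Schwarzenberger bundle *)

Section Bundle.
Variables (R : realType) (n k : nat).
Local Notation C := R[i].
Local Notation form := (Defs.form R).
Local Notation S := {mpoly C[n.+1]}.
Local Notation m := (n + k).+1.
Implicit Type b : n.+1.-tuple (form n).

Definition basis_mx b : 'M[C]_n.+1 := \matrix_(i, j) (dehom (tnth b i))`_j.

(** The form h = sum_i X_i b_i, with coefficients in the coordinate ring of
    P^n. *)
Definition tautological_form b : {poly S} :=
  \sum_(i < n.+1) 'X_i *: map_poly (@mpolyC _ C) (dehom (tnth b i)).

Lemma size_tautological_form b : (size (tautological_form b) <= n.+1)%N.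
Proof.
apply: leq_trans (size_sum _ _ _) _; apply/bigmax_leqP => i _.
apply: leq_trans (size_scale_leq _ _) _.
by rewrite (leq_trans (size_poly _ _)) ?size_dehom.
Qed.

Lemma coef_tautological_form b j :
  (tautological_form b)`_j = \sum_(i < n.+1) (dehom (tnth b i))`_j *: 'X_i.
Proof.
rewrite coef_sum; apply: eq_bigr => i _.
by rewrite coefZ coef_map mulrC mul_mpolyC.
Qed.

Lemma functionalE (w : 'rV[S]_m) (f : form (n + k)) :
  functional w f = \sum_(l < m) (dehom f)`_l *: w 0 l.
Proof. by apply: eq_bigr => l _; rewrite coef_dehom -ltnS ltn_ord. Qed.

Lemma functional_tautological b (w : 'rV[S]_m) (g : form k) :
  \sum_(i < n.+1) 'X_i * functional w (mpoly_of_dhomog (tnth b i) * g) =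
  \sum_(l < m) (tautological_form b * map_poly (@mpolyC _ C) (dehom g))`_l * w 0 l.
Proof.
transitivity (\sum_(i < n.+1) \sum_(l < m)
    'X_i * ((dehom (tnth b i) * dehom g)`_l *: w 0 l)).
  apply: eq_bigr => i _; rewrite -mulr_sumr; congr (_ * _).
  have homM := dhomogM (dhomog_is_dhomog (tnth b i)) (dhomog_is_dhomog g).
  by rewrite (functionalE w (DHomog homM)) /= rmorphM.
rewrite exchange_big; apply: eq_bigr => l _ /=.
rewrite mulr_suml coef_sum mulr_suml; apply: eq_bigr => i _.
rewrite -scalerAl coefZ -(rmorphM (map_poly (@mpolyC _ C))) coef_map /=.
by rewrite -mulrA mul_mpolyC.
Qed.

(** The rows of [shifts] are the products h x^i, and the monomials x^i span
    the forms of degree k. *)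
Lemma dual_sectionP b d (w : 'rV[S]_m) : dual_section b d w <->
  (forall j, w 0 j \is d.-homog) /\ shifts k m (tautological_form b) *m w^T = 0.
Proof.
split=> [[homw dw]|[homw Hw]]; split=> //.
  apply/matrixP => i z; rewrite ord1 !mxE.
  have szX : (size ('X^i : {poly C}) <= k.+1)%N by rewrite size_polyXn.
  transitivity (\sum_(l < m) (tautological_form b * map_poly (@mpolyC n.+1 C) 'X^i)`_l * w 0 l).
    by apply: eq_bigr => l _; rewrite !mxE map_polyXn.
  by rewrite -(homogenizeK szX) -functional_tautological dw.
move=> g; rewrite functional_tautological; move: (dehom g) (size_dehom g) => {}g szg.
have gE : g = \sum_(i < k.+1) g`_i *: 'X^i.
  rewrite -poly_def; apply/polyP => j; rewrite coef_poly; case: ltnP => // le_j.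
  by rewrite nth_default // (leq_trans szg).
rewrite {1}gE rmorph_sum mulr_sumr /=.
transitivity (\sum_(i < k.+1) g`_i *: (shifts k m (tautological_form b) *m w^T) i 0); last first.
  by rewrite Hw big1 // => i _; rewrite mxE scaler0.
under eq_bigr => l _ do rewrite coef_sum mulr_suml.
rewrite exchange_big; apply: eq_bigr => i _ /=.
rewrite mxE scaler_sumr; apply: eq_bigr => l _; rewrite !mxE.
by rewrite map_polyZ map_polyXn -scalerAr coefZ mul_mpolyC scalerAl.
Qed.

Lemma mul_dual_sections b r (d : 'I_r -> nat) (w : 'I_r -> 'rV[S]_m) :
  (forall i, dual_section b (d i) (w i)) ->
  shifts k m (tautological_form b) *m (\matrix_(l, i) w i 0 l) = 0.
Proof.
move=> dw; apply/matrixP => i j; have /dual_sectionP[_ Hw] := dw j.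
transitivity ((shifts k m (tautological_form b) *m (w j)^T) i 0); last by rewrite Hw !mxE.
rewrite [LHS]mxE [RHS]mxE; apply: eq_bigr => l _; congr (_ * _).
by rewrite !mxE.
Qed.

Definition form_mx r (f : r.-tuple (form (n + k))) : 'M[C]_(r, m) :=
  \matrix_(j, l) (dehom (tnth f j))`_l.

Local Notation mxC := (map_mx (@mpolyC n.+1 C)).

Lemma det_functional r (f : r.-tuple (form (n + k))) (w : 'I_r -> 'rV[S]_m) :
  \det (\matrix_(i < r, j < r) functional (w i) (tnth f j)) =
  \det (mxC (form_mx f) *m \matrix_(l, i) w i 0 l).
Proof.
rewrite -det_tr; congr (\det _); apply/matrixP => j i; rewrite !mxE functionalE.
by apply: eq_bigr => l _; rewrite !mxE mul_mpolyC.
Qed.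

Lemma poncelet_dim : (k.+1 + n = m)%N.
Proof. by rewrite addSn addnC. Qed.

Definition poncelet_mx b (F : 'M[C]_(n, m)) : 'M[S]_m :=
  stack poncelet_dim (shifts k m (tautological_form b)) (mxC F).

End Bundle.

Section Schemes.
Variables (R : realType) (n k : nat).
Local Notation C := R[i].
Local Notation form := (Defs.form R).
Local Notation S := {mpoly C[n.+1]}.
Local Notation m := (n + k).+1.
Local Notation mxC := (map_mx (@mpolyC n.+1 C)).
Local Notation dim := (@poncelet_dim n k).
Variable b : n.+1.-tuple (form n).
Hypothesis unit_b : basis_mx b \in unitmx.
Local Notation H := (shifts k m (tautological_form b)).
Local Notation A i := (stack dim H (outside_mx S n k m i)).

(** The coefficients of h span the linear forms on P^n, since b is a basis. *)
Lemma radical_vars (I : S -> Prop) : radical_ideal I ->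
  (forall i, (i <= n)%N -> I (\det (A i))) -> forall j, I 'X_j.
Proof.
move=> radI /(radical_coef radI (size_tautological_form b)) Ic j.
pose X : 'rV[S]_n.+1 := \row_i 'X_i.
have -> : 'X_j = \sum_i (invmx (basis_mx b) i j)%:MP * (tautological_form b)`_i.
  transitivity ((X *m mxC (basis_mx b) *m mxC (invmx (basis_mx b))) 0 j).
    by rewrite -mulmxA -map_mxM mulmxV // map_mx1 mulmx1 mxE.
  rewrite mxE; apply: eq_bigr => i _; rewrite mulrC [in RHS]coef_tautological_form !mxE.
  by congr (_ * _); apply: eq_bigr => l _; rewrite !mxE mulrC mul_mpolyC.
by apply: radical_sum => // i; apply: (radicalM radI).
Qed.

Let homH i j : H i j \is 1.-homog.
Proof.
rewrite mxE coefMXn; case: ifP => _; first exact: dhomog0.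
rewrite coef_tautological_form; apply: rpred_sum => l _; apply: dhomogZ.
by rewrite dhomogX; apply/eqP; apply: mdeg1.
Qed.

Let homO i j l : outside_mx S n k m i j l \is 0.-homog.
Proof.
rewrite mxE -mulr_natl mulr1 -[_%:R]/((_ : nat)%:R).
by case: (_ == _); [exact: dhomog1 | exact: dhomog0].
Qed.

Lemma dual_adjr i (phi : 'cV[C]_n) :
  dual_section b k.+1 (adjr dim (A i) *m mxC phi)^T.
Proof.
apply/dual_sectionP; split=> [j|]; last first.
  by rewrite trmxK mulmxA; have [-> _] := mul_adjr dim H (outside_mx S n k m i); rewrite mul0mx.
rewrite mxE; rewrite mxE; apply: rpred_sum => l _.
rewrite [map_mx _ _ _ _]mxE mulrC mul_mpolyC; apply: dhomogZ.
exact: adjr_homog.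
Qed.

(** The bundle is locally free, so a linear form on the fibre at x is the
    value of a section of the dual.  Concretely, det A_i does not vanish at x
    for some i by [radical_vars], and [scale_adjr] at the point x gives the
    section. *)
Lemma dual_section_lift (x : 'rV[C]_n.+1) (phi : 'cV[C]_m) (ev := meval (fun i => x 0 i)) :
  x != 0 -> map_mx ev H *m phi = 0 ->
  exists2 w, dual_section b k.+1 w & forall l, ev (w 0 l) = phi l 0.
Proof.
move=> nz_x Hphi.
have [i nz_i] : exists i, ev (\det (A i)) != 0.
  case: (boolP [exists i : 'I_n.+1, ev (\det (A i)) != 0]) => [/existsP[i0 ?]|]; first by exists i0.
  rewrite negb_exists => /forallP Ai0; case/negP: nz_x; apply/eqP/rowP => j.
  rewrite mxE -[LHS](mevalXU (fun i => x 0 i)).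
  apply: (@radical_vars (fun p => ev p = 0)); last first.
    by move=> i le_i; apply/eqP; rewrite -[_ == _]negbK (Ai0 (Ordinal (le_i : (i < n.+1)%N))).
  split=> [|p q p0 q0|q p p0|p l].
  - exact: meval0.
  - by rewrite [LHS]mevalD -!/(ev _) p0 q0 addr0.
  - by rewrite [LHS]mevalM -!/(ev _) p0 mulr0.
  by rewrite /ev [meval _ _]rmorphXn => /eqP; rewrite expf_eq0 => /andP[_ /eqP].
pose psi := (ev (\det (A i)))^-1 *: (outside_mx C n k m i *m phi).
exists (adjr dim (A i) *m mxC psi)^T; first exact: dual_adjr.
move=> l; transitivity ((map_mx ev (adjr dim (A i) *m mxC psi)) l 0).
  by rewrite !mxE.
have evC p q (M : 'M[C]_(p, q)) : map_mx ev (mxC M) = M.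
  by apply/matrixP => ? ?; rewrite !mxE /ev mevalC.
have evO : map_mx ev (outside_mx S n k m i) = outside_mx C n k m i.
  by apply/matrixP => ? ?; rewrite !mxE /ev rmorph_nat.
rewrite map_mxM evC map_adjr map_stack evO /psi -scalemxAr -scale_adjr //.
by rewrite -evO -map_stack det_map_mx scalerA mulVf // scale1r.
Qed.

Lemma poncelet_hypersurface_homog (F : 'M[C]_(n, m)) :
  \det (poncelet_mx b F) \is k.+1.-homog.
Proof.
apply: det_stack_homog => // i j.
by rewrite mxE -[_%:MP]alg_mpolyC; apply: dhomogZ; apply: dhomog1.
Qed.

(** Where det A_i is invertible, the equations on both sides divide each
    other by [det_mul_stack] and [det_stack_adjr]; by [radical_vars] these open
    sets cover P^n. *)
Lemma wedge_hypersurface (f : n.-tuple (form (n + k))) :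
  same_subscheme (hypersurface (poncelet_hypersurface_homog (form_mx f)))
    (wedge_zero_scheme b f).
Proof.
set D := \det _; split=> p.
  move=> [d [w [dw ->]]] i; rewrite det_functional.
  apply: (radical_vars (colon_radical_ideal _ _)) i.
  move=> i _; exists (k.+2 + n)%N; rewrite det_mul_stack; last exact: mul_dual_sections dw.
  exact: in_ideal_gen.
move=> -> {p} i; apply: (radical_vars (colon_radical_ideal _ _)) i.
move=> i _; exists m; rewrite det_stack_adjr; apply: in_ideal_gen.
exists (fun=> k.+1), (fun j => (adjr dim (A i) *m mxC (delta_mx j 0))^T); split.
  by move=> j; apply: dual_adjr.
rewrite det_functional; congr (\det (_ *m _)); apply/matrixP => l j.
rewrite !mxE (bigD1 j) //= big1 ?addr0 => [|j' ne]; rewrite !mxE ?eqxx.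
  by rewrite mpolyC1 mulr1.
by rewrite (negPf ne) mpolyC0 mulr0.
Qed.

End Schemes.

(** * Poncelet varieties defined by n - 1 sections have codimension 2 *)

Section Points.
Variable K : numClosedFieldType.

Definition powers m (z : K) : 'cV[K]_m := \col_l z ^+ l.

Lemma mul_powers m (u : 'rV[K]_m) z : u *m powers m z = (rVpoly u).[z]%:M.
Proof.
apply/matrixP => i j; rewrite !ord1 [RHS]mxE mulr1n mxE.
rewrite [rVpoly u]poly_def horner_sum; apply: eq_bigr => l _.
by rewrite valK !mxE hornerZ hornerXn.
Qed.

(** The matrix of the values at m distinct points has rank r, since a
    Vandermonde matrix is invertible.  Keep r columns which carry the rank. *)
Lemma general_points r m (M : 'M[K]_(r, m)) : row_free M ->
  exists z : 'I_r -> K, M *m \matrix_(l, i) z i ^+ l \in unitmx.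
Proof.
move=> freeM; pose V : 'M[K]_m := Vandermonde m (\row_i i%:R).
have unitV : V \in unitmx.
  rewrite unitmxE det_Vandermonde unitfE; apply/prodf_neq0 => i _.
  apply/prodf_neq0 => j lt_ij; rewrite !mxE subr_eq0 eqr_nat.
  by rewrite gtn_eqF.
have fullA : row_full (M *m V)^T.
  by rewrite -col_leq_rank mxrank_tr mxrankMfree ?row_free_unit // (eqP freeM).
exists (fun i => (fullrankfun fullA i)%:R).
rewrite -unitmx_tr; have := fullrowsub_unit fullA.
congr (_ \in unitmx); apply/matrixP => i j; rewrite !mxE.
by apply: eq_bigr => l _; rewrite !mxE.
Qed.

End Points.

Section PointForms.
Variables (R : realType) (n k r : nat).
Local Notation C := R[i].
Local Notation form := (Defs.form R).
Local Notation S := {mpoly C[n.+1]}.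
Local Notation m := (n + k).+1.
Variable b : n.+1.-tuple (form n).
Hypothesis unit_b : basis_mx b \in unitmx.
Local Notation mxC := (map_mx (@mpolyC n.+1 C)).

Definition point_form (x : 'rV[C]_n.+1) : {poly C} := rVpoly (x *m basis_mx b).

Definition coords (p : {poly C}) : 'rV[C]_n.+1 := poly_rV p *m invmx (basis_mx b).

Lemma point_formE (x : 'rV[C]_n.+1) :
  point_form x = \sum_(i < n.+1) x 0 i *: dehom (tnth b i).
Proof.
apply/polyP => j; rewrite coef_rVpoly coef_sum; case: insubP => [j' _ <-|].
  by rewrite mxE; apply: eq_bigr => i _; rewrite coefZ [basis_mx _ _ _]mxE.
rewrite -leqNgt => le_j; rewrite big1 // => i _.
by rewrite coefZ nth_default ?mulr0 // (leq_trans (size_dehom _)).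
Qed.

Lemma size_point_form x : (size (point_form x) <= n.+1)%N.
Proof. exact: size_poly. Qed.

Lemma coordsK (p : {poly C}) : (size p <= n.+1)%N -> point_form (coords p) = p.
Proof. by move=> szp; rewrite /point_form /coords mulmxKV // poly_rV_K. Qed.

Lemma point_formK : cancel point_form coords.
Proof. by move=> x; rewrite /point_form /coords rVpolyK mulmxK. Qed.

Lemma map_shifts_tautological (x : 'rV[C]_n.+1) :
  map_mx (meval (fun i => x 0 i)) (shifts k m (tautological_form b)) = shifts k m (point_form x).
Proof.
apply/matrixP => i j; rewrite !mxE !coefMXn; case: ifP => _; first exact: meval0.
rewrite coef_tautological_form raddf_sum /= /point_form coef_rVpoly.
case: insubP => [l _ <-|].
  by rewrite mxE; apply: eq_bigr => s _; rewrite mevalZ mevalXU mxE mulrC.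
rewrite -leqNgt => le_l; rewrite big1 // => s _.
by rewrite nth_default ?scale0r ?meval0 // (leq_trans (size_dehom _)).
Qed.

Variable f : r.-tuple (form (n + k)).

(** Sections of the dual kill the combination sum_j t_j f_j = h g. *)
Lemma on_wedge_zero_scheme (x : 'rV[C]_n.+1) (t : 'rV[C]_r) (g : {poly C}) :
  t != 0 -> (size g <= k.+1)%N ->
  rVpoly (t *m form_mx f) = point_form x * g ->
  on_subscheme (wedge_zero_scheme b f) x.
Proof.
move=> nz_t szg tf p [d [w [dw ->]]]; rewrite det_functional.
set W := \matrix_(_, _) _; pose ev : {rmorphism S -> C} := meval (fun i => x 0 i).
rewrite -[LHS]/(ev _) -det_map_mx map_mxM; apply/eqP/det0P; exists t => //.
have -> : map_mx ev (mxC (form_mx f)) = form_mx f.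
  by apply/matrixP => ? ?; rewrite !mxE; apply: mevalC.
rewrite mulmxA -[t *m _]rVpolyK tf -(poly_rV_K szg) -mul_shifts -map_shifts_tautological.
by rewrite -mulmxA -map_mxM (mul_dual_sections dw) map_mx0 mulmx0.
Qed.

(** Evaluation at a root of h kills the multiples of h, hence it is the value
    at x of a section of the dual by [dual_section_lift].  The r roots z_i give
    an equation whose value at x is the determinant of the f_j(z_i). *)
Lemma off_wedge_zero_scheme (x : 'rV[C]_n.+1) (z : 'I_r -> C) : x != 0 ->
  (forall i, (point_form x).[z i] = 0) ->
  form_mx f *m \matrix_(l, i) z i ^+ l \in unitmx ->
  ~ on_subscheme (wedge_zero_scheme b f) x.
Proof.
move=> nz_x hz unit_fz Zx.
have lift i : exists w, dual_section b k.+1 w /\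
    forall l, (w 0 l).@[fun i => x 0 i] = powers m (z i) l 0.
  have [|w dw wx] := dual_section_lift (k := k) (phi := powers m (z i)) unit_b nz_x.
    rewrite map_shifts_tautological; apply/row_matrixP => j; rewrite row_mul row0.
    rewrite rowE mul_shifts mul_powers poly_rV_K.
      by rewrite rVpoly_delta hornerM hz mul0r raddf0.
    rewrite rVpoly_delta; apply: leq_trans (size_polyMleq _ _) _.
    rewrite size_polyXn addnS /= -addSn; apply: leq_add.
      exact: size_point_form.
    by rewrite -ltnS ltn_ord.
  by exists w.
have [w dwx] := fin_all_exists lift; move: unit_fz; rewrite unitmxE unitfE.
have Wp : equations (wedge_zero_scheme b f)
    (\det (\matrix_(i, j) functional (w i) (tnth f j))).
  by exists (fun=> k.+1), w; split=> // i; have [] := dwx i.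
move/Zx: Wp; rewrite det_functional; set W := \matrix_(_, _) _.
pose ev : {rmorphism S -> C} := meval (fun i => x 0 i).
rewrite -[LHS]/(ev _) -det_map_mx map_mxM => <-.
apply/negP/negPn/eqP; congr (\det (_ *m _)).
  by apply/matrixP => ? ?; rewrite !mxE; exact/esym/mevalC.
by apply/matrixP => l i; have [_ /(_ l)] := dwx i; rewrite !mxE => <-.
Qed.

End PointForms.

Section Codimension.
Variables (R : realType) (n k r : nat).
Local Notation C := R[i].
Local Notation form := (Defs.form R).
Local Notation m := (n + k).+1.
Variable b : n.+1.-tuple (form n).
Hypothesis unit_b : basis_mx b \in unitmx.
Hypothesis r_n : r.+1 = n.
Variable f : r.-tuple (form (n + k)).
Hypothesis free_f : free f.

Lemma point_form_inj : injective (point_form b).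
Proof. exact: can_inj (point_formK unit_b). Qed.

Lemma point_form_lin c x y : point_form b (c *: x + y) = c *: point_form b x + point_form b y.
Proof. by rewrite /point_form mulmxDl -scalemxAl linearP. Qed.

Lemma point_form_lin2 c d x y : point_form b (c *: x + d *: y) =
  c *: point_form b x + d *: point_form b y.
Proof. by rewrite /point_form mulmxDl -!scalemxAl linearD !linearZ. Qed.

Lemma point_form0 : point_form b 0 = 0.
Proof. by rewrite /point_form mul0mx linear0. Qed.

(** The line is that of the multiples of prod_i (X - z_i), where the
    evaluations at z_1, ..., z_r are independent on the f_j: all its points have
    the roots z_i.  For a plane, spanned by three forms h_i, apply
    [net_degenerate] to the multiplications by the h_i, from forms of degree k
    to forms of degree n + k modulo the f_j: the target has dimension k + 2. *)
Lemma wedge_codim2 : has_codim (wedge_zero_scheme b f) 2.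
Proof.
split.
  have [z unit_fz] := general_points (etrans (esym (free_dehom f)) free_f).
  pose p := \prod_(i < r) ('X - (z i)%:P).
  have sz_p : size p = n by rewrite /p -big_enum size_prod_XsubC size_enum_ord.
  have nz_p : p != 0 by rewrite -size_poly_eq0 sz_p -r_n.
  pose u := coords b p; pose v := coords b (p * 'X).
  have hu : point_form b u = p by rewrite coordsK ?sz_p.
  have hv : point_form b v = p * 'X by rewrite coordsK ?size_mulX ?sz_p.
  exists <<[:: u; v]>>%VS.
    apply/eqP; rewrite -[2%N]/(size [:: u; v]) -/(free _).
    rewrite free_cons seq1_free span_seq1; apply/andP; split.
      apply/negP => /vlineP[c uv]; move: hu.
      rewrite uv -[c *: v]addr0 point_form_lin point_form0 addr0 hv.
      move=> /(congr1 (fun q : {poly C} => size q)).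
      apply/eqP; rewrite sz_p; case: (eqVneq c 0) => [->|nz_c].
        by rewrite scale0r size_poly0 -r_n.
      by rewrite size_scale // size_mulX // sz_p gtn_eqF.
    apply: contraNneq nz_p => v0; move: hv; rewrite v0 point_form0 => /esym/eqP.
    by rewrite mulf_eq0 polyX_eq0 orbF.
  move=> [x [xU nz_x]].
  have : x \in <<[:: u; v]>>%VS := xU.
  rewrite span_cons span_seq1 => /memv_addP[_ /vlineP[c ->] [_ /vlineP[d ->] xE]].
  apply: (off_wedge_zero_scheme unit_b (z := z) nz_x _ unit_fz) => i.
  rewrite xE point_form_lin2 hu hv.
  have pz : p.[z i] = 0 by rewrite /p horner_prod (bigD1 i) //= hornerXsubC subrr mul0r.
  by rewrite hornerD !hornerZ hornerMX pz !(mul0r, mulr0) addr0.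
move=> U dimU.
have sz_b : size (vbasis U) = 3%N by rewrite size_tuple dimU.
pose M (i : nat) := shifts k m (point_form b (vbasis U)`_i) *m
  col_base (cokermx (form_mx f)).
have rank_coker : (\rank (cokermx (form_mx f)) <= k.+2)%N.
  rewrite mxrank_coker (eqP (etrans (esym (free_dehom f)) free_f)).
  by rewrite leq_subLR -r_n !addSn !addnS.
have [s0 [s1 [s2 [g [nz_s nz_g gM]]]]] :=
  net_degenerate (M 0%N) (M 1%N) (M 2%N) isT rank_coker.
pose F (i : nat) := [:: s0; s1; s2]`_i *: (vbasis U)`_i.
pose x := \sum_(i < 3) F i.
have xU : x \in U.
  by apply: rpred_sum => i _; apply/rpredZ/vbasis_mem/mem_nth; rewrite sz_b.
have xE : x = \sum_(i < \dim U) F i by rewrite dimU.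
have nz_x : x != 0.
  apply/eqP; rewrite xE; have /freeP freeU := basis_free (vbasisP U) => x0.
  have s0E := freeU (fun j => [:: s0; s1; s2]`_j) x0.
  have sE i (lti : (i < \dim U)%N) : [:: s0; s1; s2]`_i = 0 := s0E (Ordinal lti).
  have [s00 s10 s20] : [/\ s0 = 0, s1 = 0 & s2 = 0].
    by split; [apply: (sE 0%N) | apply: (sE 1%N) | apply: (sE 2%N)]; rewrite dimU.
  by rewrite s00 s10 s20 eqxx in nz_s.
exists x; split=> //.
have hx : point_form b x = s0 *: point_form b (vbasis U)`_0 +
    s1 *: point_form b (vbasis U)`_1 + s2 *: point_form b (vbasis U)`_2.
  rewrite /x /F !big_ord_recl big_ord0 /= addr0.
  by rewrite point_form_lin point_form_lin2 addrA.
have : (g *m shifts k m (point_form b x) <= form_mx f)%MS.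
  rewrite submxE -[cokermx _]mulmx_base mulmxA.
  rewrite (_ : _ *m col_base _ = 0) ?mul0mx // -[RHS]gM -mulmxA; congr (_ *m _).
  rewrite /M !scalemxAl -!mulmxDl; congr (_ *m _).
  by rewrite hx -addrA !shifts_lin shiftsZ addrA.
rewrite mul_shifts => /submxP[t tE].
have szh : (size (point_form b x * rVpoly g)%R <= m)%N.
  apply: leq_trans (size_polyMleq _ _) _.
  rewrite -subn1 leq_subLR add1n -addnS -addSn.
  by apply: leq_add; [exact: size_point_form | exact: size_poly].
apply: (@on_wedge_zero_scheme _ _ _ _ _ _ _ t (rVpoly g)).
- apply: contraNneq nz_g => t0; move: tE; rewrite t0 mul0mx => /(congr1 rVpoly).
  rewrite poly_rV_K // linear0 => /eqP; rewrite mulf_eq0 => /orP[/eqP hx0|/eqP g0].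
    by case/eqP: nz_x; apply: point_form_inj; rewrite hx0 point_form0.
  by apply/eqP; rewrite -[g]rVpolyK g0 linear0.
- exact: size_poly.
by rewrite -tE poly_rV_K.
Qed.

End Codimension.

(** * Planes of forms with n - 2 fixed roots *)

(** Binet's formula for a linear recurrence with characteristic roots s
    and t. *)
Lemma binet (T : comNzRingType) (s t : T) (a : nat -> T) d :
  (forall j, (j.+2 <= d)%N -> a j.+2 = (s + t) * a j.+1 - s * t * a j) ->
  forall j, (j <= d)%N ->
  (s - t) * a j = s ^+ j * (a 1%N - t * a 0%N) - t ^+ j * (a 1%N - s * a 0%N).
Proof.
move=> rec; elim/ltn_ind => -[|[|j]] IHj le_j.
- by rewrite !expr0; ring.
- by rewrite !expr1; ring.
have e1 := IHj j.+1 (ltnSn _) (ltnW le_j).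
have e0 := IHj j (ltnW (ltnSn _)) (ltnW (ltnW le_j)).
rewrite rec //.
transitivity ((s + t) * ((s - t) * a j.+1) - s * t * ((s - t) * a j)); first by ring.
by rewrite e1 e0 !exprS; ring.
Qed.

(** Write s and t for the inner and the outer variable.  Divide u by Phi(t)
    and use the bound on the degree in t: (s - t) G = u2 Phi(s) + c(s) Phi(t).
    As G vanishes at t = beta, Phi(s) divides c(s), so that
    (s - t) G = Phi(s) E.  By the bound on the degree in s, the coefficients of
    E are constants, and they are 0 because G vanishes at s = beta. *)
Lemma bivariate_vanish (K : fieldType) (Phi : {poly K}) d
    (G u v : {poly {poly K}}) (beta : K) :
  size Phi = d.+1 -> Phi.[beta] != 0 ->
  (size G <= d)%N -> (forall j, (size (G`_j)%R <= d)%N) ->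
  G.[beta%:P] = 0 -> (forall j, (G`_j).[beta] = 0) ->
  ('X%:P - 'X) * G = u * Phi%:P + v * map_poly polyC Phi -> G = 0.
Proof.
move=> szPhi nz_Phib szG szGj Gb Gjb; set w := _ * G; set P2 := map_poly _ _ => wE.
(* P2 is Phi(t), and Phi%:P is Phi(s). *)
have szP2 : size P2 = d.+1 by rewrite size_map_polyC.
have nz_P2 : P2 != 0 by rewrite -size_poly_eq0 szP2.
have unitP2 : lead_coef P2 \is a GRing.unit.
  rewrite lead_coef_map poly_unitE size_polyC coefC /= unitfE lead_coef_eq0.
  by rewrite -size_poly_eq0 szPhi.
have P2b : P2.[beta%:P] = Phi.[beta]%:P by rewrite horner_map.
have szw : (size w <= d.+1)%N.
  apply: leq_trans (size_polyMleq _ _) _.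
  have szL : (size ('X%:P - 'X : {poly {poly K}})%R <= 2)%N.
    by rewrite -opprB size_polyN size_XsubC.
  rewrite -subn1 leq_subLR add1n; exact: (leq_add szL szG).
have wj j : w`_j = 'X * G`_j - (if j is j'.+1 then G`_j' else 0).
  by rewrite /w mulrBl coefB coefCM coefXM; case: j.
have wjb j : (w`_j).[beta] = 0.
  rewrite wj hornerD hornerN hornerM Gjb mulr0 sub0r.
  by case: j => [|j]; rewrite ?Gjb ?horner0 oppr0.
have szwj j : (size (w`_j)%R <= d.+1)%N.
  rewrite wj; apply: leq_trans (size_polyD _ _) _; rewrite size_polyN geq_max.
  apply/andP; split; last by case: j => [|j]; rewrite ?size_poly0 // ltnW // ltnS.
  apply: leq_trans (size_polyMleq _ _) _.
  by rewrite size_polyX add2n /= ltnS.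
have [u1 [u2 [uE szu2]]] : exists u1 u2, u = u1 * P2 + u2 /\ (size u2 <= d)%N.
  exists (u %/ P2), (u %% P2); split; first exact: Pdiv.IdomainUnit.divp_eq.
  by rewrite -ltnS -szP2 ltn_modp.
have {}wE : w = u2 * Phi%:P + (v + u1 * Phi%:P) * P2 by rewrite wE uE; ring.
have [c cE] : exists c, v + u1 * Phi%:P = c%:P.
  apply/ex_intro/size1_polyC.
  case: (eqVneq (v + u1 * Phi%:P) 0) => [->|nz]; first by rewrite size_poly0.
  have : (size ((v + u1 * Phi%:P) * P2)%R <= d.+1)%N.
    rewrite (_ : (v + u1 * Phi%:P) * P2 = w - u2 * Phi%:P); last by rewrite wE; ring.
    apply: leq_trans (size_polyD _ _) _; rewrite size_polyN geq_max szw.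
    rewrite mulrC mul_polyC (leq_trans (size_scale_leq _ _)) //.
    exact: leq_trans szu2 _.
  by rewrite size_mul // szP2 addnS /= -[X in (_ <= X)%N]add1n leq_add2r.
rewrite {}cE in wE.
have cE : c = - (Phi.[beta]^-1 *: u2.[beta%:P]) * Phi.
  have := congr1 (horner^~ beta%:P) wE.
  rewrite !hornerM !hornerD !hornerM Gb mulr0 !hornerC P2b => /esym/eqP.
  rewrite addrC addr_eq0 => /eqP cP.
  rewrite mulNr -scalerAl -scalerN -cP mulrC mul_polyC scalerA mulVf ?scale1r //.
pose E := u2 - (Phi.[beta]^-1 *: u2.[beta%:P])%:P * P2.
have {}wE : w = Phi%:P * E by rewrite wE cE /E polyCM polyCN; ring.
have E0 : E = 0.
  apply/polyP => j; rewrite coef0.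
  have wEj : w`_j = Phi * E`_j by rewrite wE coefCM.
  case: (eqVneq E`_j 0) => // nz_Ej.
  have /size1_polyC Ejc : (size (E`_j)%R <= 1)%N.
    have := szwj j; rewrite wEj size_mul // -?size_poly_eq0 ?szPhi //.
    by rewrite addSn /= -addn1 leq_add2l.
  have := wjb j; rewrite wEj hornerM Ejc hornerC => /eqP.
  by rewrite mulf_eq0 (negPf nz_Phib) => /eqP ->.
have /eqP : w = 0 by rewrite wE E0 mulr0.
rewrite mulf_eq0 => /orP[|/eqP //].
by rewrite -opprB oppr_eq0 polyXsubC_eq0.
Qed.

Section Factor.
Variable K : numClosedFieldType.

(** A form of degree j + 1 which does not vanish at c has a linear factor
    1 - a (X - c).  The root at infinity corresponds to a = 0. *)
Lemma linear_factor (c : K) j (s : {poly K}) : (size s <= j.+2)%N -> s.[c] != 0 ->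
  exists a (s' : {poly K}), [/\ s = (1 - a *: ('X - c%:P)) * s', (size s' <= j.+1)%N & s'.[c] != 0].
Proof.
move=> szs nz_sc; case: (leqP (size s) j.+1) => [le_s|lt_s].
  by exists 0, s; rewrite scale0r subr0 mul1r.
have /closed_rootP[z /factor_theorem[g sE]] : size s != 1%N.
  by rewrite gtn_eqF // (leq_ltn_trans _ lt_s).
have nz_cz : c - z != 0.
  by apply: contraNneq nz_sc => cz; rewrite sE hornerM hornerXsubC cz mulr0.
have nz_g : g.[c] != 0.
  by apply: contraNneq nz_sc => gc; rewrite sE hornerM gc mul0r.
exists (- (c - z)^-1), ((c - z) *: g); split.
- rewrite sE mulrC -scalerAr scalerAl; congr (_ * _).
  rewrite scalerBr scalerA mulrN divff // scaleN1r opprK.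
  by rewrite -[(c - z) *: 1]/((c - z)%:A) alg_polyC polyCB; ring.
- rewrite size_scale // -ltnS; apply: leq_trans szs.
  rewrite sE size_Mmonic ?monicXsubC ?size_XsubC ?addn2 //.
  by apply: contraNneq nz_g => ->; rewrite horner0.
by rewrite hornerZ mulf_neq0.
Qed.

End Factor.

Section QuadraticSubstitution.
Variables (K : comNzRingType) (n : nat) (y0 y1 y2 : 'I_n -> K).
Local Notation T := {poly {poly K}}.
Local Notation s := ('X%:P : T).
Local Notation t := ('X : T).
Local Notation CT z := (z%:P%:P : T).

(** The coordinates of q (1 - s mu) (1 - t mu) when y0, y1, y2 are those of
    q, q mu and q mu^2. *)
Definition slice_var (i : 'I_n) : T :=
  CT (y0 i) - (s + t) * CT (y1 i) + s * t * CT (y2 i).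

Definition slice : {mpoly K[n]} -> T := mmap (polyC \o polyC) slice_var.

HB.instance Definition _ := GRing.RMorphism.copy slice
  (mmap (polyC \o (@polyC K)) slice_var).

Lemma sliceC z : slice z%:MP = CT z. Proof. exact: mmapC. Qed.

Lemma sliceX i : slice 'X_i = slice_var i.
Proof. by rewrite /slice mmapX mmap1U. Qed.

Lemma sliceZ z p : slice (z *: p) = CT z * slice p.
Proof. by rewrite -mul_mpolyC rmorphM /= sliceC. Qed.

Lemma slice_linear (e : 'I_n -> K) : slice (\sum_i (e i)%:MP * 'X_i) =
  CT (\sum_i e i * y0 i) - (s + t) * CT (\sum_i e i * y1 i) +
  s * t * CT (\sum_i e i * y2 i).
Proof.
rewrite !rmorph_sum !mulr_sumr -sumrB -big_split; apply: eq_bigr => i _ /=.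
by rewrite rmorphM /= sliceC sliceX /slice_var !polyCM; ring.
Qed.

Lemma slice_horner p a1 a2 : (slice p).[a2%:P].[a1] =
  p.@[fun i => y0 i - (a1 + a2) * y1 i + a1 * a2 * y2 i].
Proof.
apply: (mpoly_morph_ext (f := horner_eval a1 \o (horner_eval a2%:P \o slice))
   (g := meval (fun i => y0 i - (a1 + a2) * y1 i + a1 * a2 * y2 i))) => [z|i] /=.
  by rewrite sliceC mevalC /horner_eval !hornerC.
rewrite sliceX mevalXU /slice_var /horner_eval.
by rewrite !(hornerD, hornerN, hornerM, hornerC, hornerX).
Qed.

Lemma slice_sym p : swapXY (slice p) = slice p.
Proof.
apply: (mpoly_morph_ext (f := swapXY \o slice) (g := slice)) => [z|i] /=.
  by rewrite sliceC swapXY_polyC map_polyC.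
rewrite sliceX /slice_var !(rmorphD, rmorphN, rmorphM) /= swapXY_X swapXY_Y.
by rewrite !swapXY_polyC !map_polyC /= [s + t]addrC [s * t]mulrC.
Qed.

Lemma size_slice d p : p \is d.-homog -> (size (slice p) <= d.+1)%N.
Proof.
move=> homp; apply: size_mmap_homog => // i; rewrite /slice_var.
have -> : CT (y0 i) - (s + t) * CT (y1 i) + s * t * CT (y2 i) =
    ((y0 i)%:P - (y1 i)%:P * 'X)%:P + ((y2 i)%:P * 'X - (y1 i)%:P)%:P * t.
  by rewrite !(polyCB, polyCM); ring.
rewrite (leq_trans (size_polyD _ _)) // geq_max (leq_trans (size_polyC_leq1 _)) //=.
by rewrite mul_polyC (leq_trans (size_scale_leq _ _)) // size_polyX.
Qed.

Lemma size_slice_coef d p j : p \is d.-homog -> (size ((slice p)`_j)%R <= d.+1)%N.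
Proof.
move=> homp; apply: leq_trans (max_size_coefXY _ _) _.
by rewrite sizeYE slice_sym size_slice.
Qed.

End QuadraticSubstitution.

Lemma cancel_constant (K : fieldType) (z : K) N (w w' : {poly {poly K}}) : z != 0 ->
  (z ^- N)%:P%:P * (w * (z%:P%:P ^+ N * w')) = w * w'.
Proof.
move=> nz_z; rewrite mulrCA -!polyC_exp; congr (_ * _).
by rewrite mulrA -!polyCM mulVf ?expf_neq0 // !mul1r.
Qed.

Section Taylor.
Variables (K : fieldType) (c : K) (d : nat) (p : {poly K}).
Hypothesis szp : (size p <= d.+1)%N.
Local Notation mu := ('X - c%:P).

(** The form p of degree d written in the coordinate 1 / (X - c), whose value
    at c is the leading coefficient. *)
Definition reverse_taylor : {poly K} :=
  \poly_(j < d.+1) (p \Po ('X + c%:P))`_(d - j).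

Lemma taylor_expansion : p = \sum_(j < d.+1) reverse_taylor`_j *: mu ^+ (d - j).
Proof.
have pE : p = (p \Po ('X + c%:P)) \Po mu.
  by rewrite -comp_polyA comp_polyD comp_polyX comp_polyC subrK comp_polyXr.
rewrite {1}pE comp_polyE.
have sz : (size (p \Po ('X + c%:P)) <= d.+1)%N.
  by rewrite size_comp_poly2 // size_XaddC.
rewrite (big_ord_widen _ (fun i => (p \Po ('X + c%:P))`_i *: mu ^+ i) sz) big_mkcond.
rewrite (reindex_inj rev_ord_inj) /=; apply: eq_bigr => j _.
rewrite subSS coef_poly ltn_ord; case: ifP => // /negbT.
by rewrite -leqNgt => le_j; rewrite nth_default ?scale0r.
Qed.

Lemma size_reverse_taylor : p.[c] != 0 -> size reverse_taylor = d.+1.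
Proof.
move=> nz; apply: size_poly_eq; rewrite subnn -horner_coef0 horner_comp.
by rewrite !hornerE.
Qed.

Lemma reverse_taylor_root beta : reverse_taylor.[beta] = 0 ->
  exists2 g : {poly K}, p = (1 - beta *: mu) * g & (size g <= d)%N.
Proof.
have [->|nz_b] := eqVneq beta 0.
  rewrite horner_coef0 scale0r subr0 coef_poly /= subn0 => p0.
  exists p; first by rewrite mul1r.
  apply/leq_sizeP => j le_j; case: (ltngtP j d) le_j => // [lt_dj _|-> _].
    by rewrite nth_default // (leq_trans szp).
  have := congr1 (fun q : {poly K} => q`_d) taylor_expansion.
  rewrite big_ord_recl coef_poly /= subn0 p0 scale0r add0r coef_sum => ->.
  apply: big1 => i _; rewrite coefZ [X in _ * X]nth_default ?mulr0 //.
  by rewrite size_exp_XsubC /= /bump leq0n add1n subnSK ?leq_subr // ltn_ord.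
move=> Phi0; have /factor_theorem[g pE] : root p (c + beta^-1).
  rewrite rootE {1}taylor_expansion horner_sum.
  have -> : \sum_(j < d.+1) (reverse_taylor`_j *: mu ^+ (d - j)).[c + beta^-1] =
      beta ^- d * reverse_taylor.[beta].
    rewrite (@horner_coef_wide _ d.+1) ?size_poly // mulr_sumr.
    apply: eq_bigr => j _; rewrite hornerZ horner_exp hornerXsubC addrC addKr.
    rewrite mulrCA; congr (_ * _).
    have e : beta ^+ d = beta ^+ (d - j) * beta ^+ j.
      by rewrite -exprD subnK // -ltnS.
    by rewrite exprVn e invfM -mulrA mulVf ?expf_neq0 // mulr1.
  by rewrite Phi0 mulr0.
exists (- beta^-1 *: g).
  rewrite {1}pE mulrC -scalerAr scalerAl; congr (_ * _).
  rewrite scalerBr scalerA mulNr mulVf // scaleN1r opprK scaleNr.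
  by rewrite -[beta^-1 *: 1]/(beta^-1%:A) alg_polyC polyCD; ring.
apply: leq_trans (size_scale_leq _ _) _.
case: (eqVneq g 0) => [->|nz_g]; first by rewrite size_poly0.
rewrite -ltnS; apply: leq_trans szp.
by rewrite pE size_Mmonic ?monicXsubC // size_XsubC addn2.
Qed.

End Taylor.

Lemma reverse_taylor_lin (K : fieldType) (c : K) d z (p q : {poly K}) :
  reverse_taylor c d (z *: p + q) =
  z *: reverse_taylor c d p + reverse_taylor c d q.
Proof.
apply/polyP => j; rewrite coefD coefZ !coef_poly comp_polyD comp_polyZ coefD coefZ.
by case: ifP => // _; rewrite mulr0 addr0.
Qed.

Section QuadraticRelation.
Variables (K : fieldType) (c : K) (k : nat).
Local Notation T := {poly {poly K}}.
Local Notation s := ('X%:P : T).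
Local Notation t := ('X : T).
Local Notation CT z := (z%:P%:P : T).
Local Notation mu := ('X - c%:P).
Variable theta : {poly K} -> T.
Hypothesis thetaD : {morph theta : e e' / e + e'}.
Hypothesis thetaZ : forall z e, theta (z *: e) = CT z * theta e.
Hypothesis theta_rel : forall g : {poly K}, (size g <= k.+1)%N ->
  theta g - (s + t) * theta (mu * g) + s * t * theta (mu ^+ 2 * g) = 0.

(** By the relation, the values of theta on the powers of mu, in decreasing
    order of the exponents, satisfy the recurrence of [binet]. *)
Lemma quadratic_relation (p : {poly K}) (Phi := reverse_taylor c k.+2 p) :
  (size p <= k.+3)%N ->
  exists u v, (s - t) * theta p = u * Phi%:P + v * map_poly polyC Phi.
Proof.
move=> szp; pose a j := theta (mu ^+ (k.+2 - j)).
have bin : forall j, (j <= k.+2)%N -> (s - t) * a j =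
    s ^+ j * (a 1%N - t * a 0%N) - t ^+ j * (a 1%N - s * a 0%N).
  apply: binet => j le_j; rewrite /a.
  have le_jk : (j <= k)%N by [].
  have := @theta_rel (mu ^+ (k - j)).
  rewrite size_exp_XsubC ltnS leq_subr => /(_ isT).
  rewrite -exprS -exprD -!subSn // add2n -!subSn ?(leqW le_jk) // => /eqP.
  rewrite -addrA addrC addr_eq0 !subSS => /eqP e; rewrite -[LHS]opprK -e; ring.
exists (a 1%N - t * a 0%N), (- (a 1%N - s * a 0%N)).
have theta0 : theta 0 = 0 by rewrite -[0](scale0r 0) thetaZ polyC0 mul0r.
rewrite {1}(taylor_expansion c szp) (big_morph theta thetaD theta0) mulr_sumr -/Phi.
transitivity (\sum_(j < k.+3) (CT Phi`_j * s ^+ j * (a 1%N - t * a 0%N) -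
  CT Phi`_j * t ^+ j * (a 1%N - s * a 0%N))).
  apply: eq_bigr => j _; rewrite thetaZ mulrCA.
  by rewrite -/(a j) bin -1?ltnS ?ltn_ord // mulrBr !mulrA.
rewrite sumrB -!mulr_suml mulNr ![_ * (a 1%N - _)]mulrC.
have PhiE : Phi = \sum_(j < k.+3) Phi`_j *: 'X^j.
  rewrite -poly_def; apply/polyP => j; rewrite [RHS]coef_poly.
  by case: ltnP => // le_j; rewrite nth_default // (leq_trans (size_poly _ _)).
congr (_ * _ - _ * _).
  rewrite [in RHS]PhiE raddf_sum; apply: eq_bigr => j _.
  by rewrite -mul_polyC /= polyCM polyC_exp.
rewrite [in RHS]PhiE raddf_sum; apply: eq_bigr => j _ /=.
by rewrite map_polyZ map_polyXn mul_polyC.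
Qed.

End QuadraticRelation.

Section Slice.
Variables (R : realType) (n k r : nat).
Local Notation C := R[i].
Local Notation form := (Defs.form R).
Local Notation S := {mpoly C[n.+1]}.
Local Notation T := {poly {poly C}}.
Local Notation m := (n + k).+1.
Local Notation CT z := (z%:P%:P : T).
Local Notation s := ('X%:P : T).
Local Notation t := ('X : T).
Variable b : n.+1.-tuple (form n).
Hypothesis unit_b : basis_mx b \in unitmx.
Variable f : r.-tuple (form (n + k)).
Variable G : S.
Hypothesis homG : G \is k.+1.-homog.
Hypothesis locG : forall i, colon_radical (wedge_equations b f) G 'X_i.

(** The value of G at the point [p] of P^n. *)
Definition value (p : {poly C}) := G.@[fun i => coords b p 0 i].

Lemma coords_lin z p p' : coords b (z *: p + p') = z *: coords b p + coords b p'.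
Proof. by rewrite /coords linearP mulmxDl scalemxAl. Qed.

Section Local.
Variables (q ft : {poly C}) (c : C) (tv : 'rV[C]_r).
Local Notation mu := ('X - c%:P : {poly C}).
Hypothesis szq : (size q < n)%N.
Hypothesis szft : (size ft <= k.+3)%N.
Hypothesis nz_tv : tv != 0.
Hypothesis tvE : rVpoly (tv *m form_mx f) = q * ft.
Hypothesis nz_qc : q.[c] != 0.
Local Notation Phi := (reverse_taylor c k.+2 ft).
Let y0 i := coords b q 0 i.
Let y1 i := coords b (q * mu) 0 i.
Let y2 i := coords b (q * mu ^+ 2) 0 i.
Local Notation psi := (slice y0 y1 y2).

Let local_ideal (w : T) := exists u v, w = u * Phi%:P + v * map_poly polyC Phi.

Let localD w w' : local_ideal w -> local_ideal w' -> local_ideal (w + w').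
Proof.
by move=> [u [v ->]] [u' [v' ->]]; exists (u + u'), (v + v'); rewrite !mulrDl addrACA.
Qed.

Let localM w w' : local_ideal w' -> local_ideal (w * w').
Proof.
by move=> [u [v ->]]; exists (w * u), (w * v); rewrite mulrDr !mulrA.
Qed.

Let local_sum (I : Type) (l : seq I) F : (forall i, local_ideal (F i)) ->
  local_ideal (\sum_(i <- l) F i).
Proof.
move=> lF; apply: (big_ind local_ideal) => //.
by exists 0, 0; rewrite !mul0r addr0.
Qed.

Lemma size_slice_center e : (e <= 2)%N -> (size (q * mu ^+ e)%R <= n.+1)%N.
Proof.
move=> le_e; apply: leq_trans (size_polyMleq _ _) _.
rewrite size_exp_XsubC addnS /=; apply: leq_trans (leq_add (leqnn _) le_e) _.
by rewrite addn2 ltnS.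
Qed.

Lemma size_slice_center1 : (size (q * mu)%R <= n.+1)%N.
Proof. by have := @size_slice_center 1 isT; rewrite expr1. Qed.

Lemma slice_functional (w : 'rV[S]_m) (F : form (n + k)) :
  psi (functional w F) = \sum_(l < m) CT (dehom F)`_l * psi (w 0 l).
Proof.
by rewrite functionalE rmorph_sum; apply: eq_bigr => l _; rewrite /= sliceZ.
Qed.

Let pairing (w : 'rV[S]_m) (p : {poly C}) := \sum_(l < m) CT p`_l * psi (w 0 l).

Lemma pairingD w : {morph pairing w : p p' / p + p'}.
Proof.
move=> p p'; rewrite -big_split; apply: eq_bigr => l _ /=.
by rewrite coefD !polyCD mulrDl.
Qed.

Lemma pairingZ w z p : pairing w (z *: p) = CT z * pairing w p.
Proof.
by rewrite mulr_sumr; apply: eq_bigr => l _; rewrite coefZ !polyCM mulrA.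
Qed.

Lemma pairing_sum w (I : Type) (l : seq I) (z : I -> C) (p : I -> {poly C}) :
  pairing w (\sum_(i <- l) z i *: p i) = \sum_(i <- l) CT (z i) * pairing w (p i).
Proof.
have pair0 : pairing w 0 = 0 by rewrite -[0](scale0r 0) pairingZ polyC0 mul0r.
rewrite (big_morph _ (pairingD w) pair0); apply: eq_bigr => i _; exact: pairingZ.
Qed.

Lemma pairing_coords w (p g : {poly C}) : (size p <= n.+1)%N ->
  pairing w (p * g) =
  \sum_(i < n.+1) CT (coords b p 0 i) * pairing w (dehom (tnth b i) * g).
Proof.
move=> szp; rewrite -pairing_sum; congr (pairing w _).
rewrite -[in LHS](coordsK unit_b szp) point_formE mulr_suml.
by apply: eq_bigr => i _; rewrite scalerAl.
Qed.

Lemma pairing_dual d w : dual_section b d w ->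
  local_ideal ((s - t) * pairing w (q * ft)).
Proof.
move=> [_ dw].
apply: (@quadratic_relation _ c k (fun e => pairing w (q * e))) szft => [e e'|z e|g szg].
- by rewrite mulrDr pairingD.
- by rewrite -scalerAr pairingZ.
have := congr1 psi (dw (homogenize k g)); rewrite rmorph_sum rmorph0 => <-.
rewrite [q * (mu * g)]mulrA [q * (_ * g)]mulrA.
rewrite !pairing_coords ?size_slice_center1 ?size_slice_center //; last exact: leqW (ltnW szq).
rewrite !mulr_sumr -sumrB -big_split; apply: eq_bigr => i _ /=.
rewrite rmorphM /= sliceX /slice_var.
have homM := dhomogM (dhomog_is_dhomog (tnth b i)) (form_subproof k g).
rewrite (slice_functional w (DHomog homM)) -/(pairing w _) /=.
rewrite rmorphM /= -[dehom (\sum_(j < k.+1) _)]/(dehom (homogenize k g)) homogenizeK //.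
rewrite -/(y0 i) -/(y1 i) -/(y2 i); move: (pairing w _) (y0 i) (y1 i) (y2 i) => P z0 z1 z2.
by rewrite [(_ - _ + _) * P]mulrDl [(_ - _) * P]mulrBl !mulrA.
Qed.

(** Since q ft = sum_j t_j f_j, Cramer's rule expresses the products of the
    determinant by the t_j as combinations of the values of the w_i on q ft. *)
Lemma wedge_local p : wedge_equations b f p -> local_ideal ((s - t) * psi p).
Proof.
move=> [d [w [dw ->]]]; set N := \matrix_(_, _) _.
have [j nz_j] : exists j, tv 0 j != 0 by apply/rV0Pn.
pose tau : 'cV[T]_r := \col_j CT (tv 0 j).
have Ntau i : (map_mx psi N *m tau) i 0 = pairing (w i) (q * ft).
  rewrite -tvE mxE.
  transitivity (\sum_(l < r) CT (tv 0 l) * pairing (w i) (dehom (tnth f l))).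
    by apply: eq_bigr => l _; rewrite !mxE slice_functional mulrC.
  rewrite -pairing_sum; apply: eq_bigr => l _; rewrite coef_rVpoly_ord mxE coef_sum.
  by congr (CT _ * _); apply: eq_bigr => l' _; rewrite mxE coefZ.
have : \adj (map_mx psi N) *m (map_mx psi N *m tau) = psi (\det N) *: tau.
  by rewrite mulmxA mul_adj_mx mul_scalar_mx det_map_mx.
move/matrixP/(_ j 0); rewrite mxE [RHS]mxE [tau j 0]mxE => detE.
rewrite -(cancel_constant 1 _ _ nz_j) expr1 [CT _ * psi _]mulrC.
rewrite -detE mulr_sumr; apply: localM; apply: local_sum => i.
rewrite mulrCA; apply: localM; rewrite Ntau; exact: pairing_dual (dw i).
Qed.

(** The value E at c of the tautological form is a linear form on P^n whose
    restriction to the slice is the nonzero constant q(c).  So the power of E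
    in the local condition on G can be cancelled. *)
Lemma slice_local : local_ideal ((s - t) * psi G).
Proof.
pose E : S := \sum_(i < n.+1) ((dehom (tnth b i)).[c])%:MP * 'X_i.
have [N [l lw GE]] : colon_radical (wedge_equations b f) G E.
  have radG := colon_radical_ideal (wedge_equations b f) G.
  by apply: (radical_sum radG) => i; apply: (radicalM radG).
have psiE : psi E = CT q.[c].
  have valE (p : {poly C}) : (size p <= n.+1)%N ->
      \sum_(i < n.+1) (dehom (tnth b i)).[c] * coords b p 0 i = p.[c].
    move=> szp; rewrite -[in RHS](coordsK unit_b szp) point_formE.
    by rewrite horner_sum; apply: eq_bigr => i _; rewrite hornerZ mulrC.
  have val0 : (q * mu).[c] = 0 by rewrite hornerM hornerXsubC subrr mulr0.
  have val1 : (q * mu ^+ 2).[c] = 0.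
    by rewrite expr2 mulrA hornerM hornerXsubC subrr mulr0.
  have v0 : \sum_i (dehom (tnth b i)).[c] * y0 i = q.[c] := valE _ (leqW (ltnW szq)).
  have v1 : \sum_i (dehom (tnth b i)).[c] * y1 i = 0.
    by rewrite -[RHS]val0; exact: valE size_slice_center1.
  have v2 : \sum_i (dehom (tnth b i)).[c] * y2 i = 0.
    by rewrite -[RHS]val1; exact: valE (size_slice_center (leqnn 2)).
  rewrite slice_linear v0 v1 v2.
  by rewrite polyC0 !mulr0 subr0 addr0.
have : local_ideal ((s - t) * psi (E ^+ N * G)).
  rewrite GE rmorph_sum mulr_sumr big_seq; apply: (big_ind local_ideal) => [||qa /lw wqa].
  - by exists 0, 0; rewrite !mul0r addr0.
  - exact: localD.
  by rewrite rmorphM mulrCA; apply: localM; apply: wedge_local.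
rewrite rmorphM rmorphXn /= psiE => /(localM (CT (q.[c] ^- N))).
by rewrite (cancel_constant _ _ _ nz_qc).
Qed.

End Local.
End Slice.

Section LinearFactors.
Variable K : fieldType.
Implicit Types (q mu w : {poly K}) (x y z : K).

Lemma expand_quadratic q mu x y : q * (1 - x *: mu) * (1 - y *: mu) =
  - (x + y) *: (q * mu) + ((x * y) *: (q * mu ^+ 2) + q).
Proof. by rewrite -!mul_polyC polyCN polyCM polyCD; ring. Qed.

Lemma rescale_factor q w w' z : z != 0 ->
  q * w' * w = q * (w * z%:P) * (z^-1 *: w').
Proof.
move=> nz_z; rewrite -mul_polyC.
transitivity ((z^-1%:P * z%:P) * (q * w' * w)); last by ring.
by rewrite -polyCM mulVf // mul1r.
Qed.

Lemma expand_quadratic_coef x y (c0 c1 c2 : K) :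
  - (x + y) * c1 + (x * y * c2 + c0) = c0 - (x + y) * c1 + x * y * c2.
Proof. by ring. Qed.

Lemma line_at_infinity x w : x != 0 ->
  w + x *: - ('X * w) = - x *: (('X - x^-1%:P) * w).
Proof.
move=> nz_x; rewrite -!mul_polyC polyCN.
transitivity ((x%:P * x^-1%:P) * w - x%:P * ('X * w)); last by ring.
by rewrite -polyCM divff // mul1r mulrN.
Qed.

End LinearFactors.

Lemma row_lin3E (K : comNzRingType) p (u v w : 'rV[K]_p) x y i :
  (x *: u + (y *: v + w)) 0 i = x * u 0 i + (y * v 0 i + w 0 i).
Proof. by rewrite !mxE. Qed.

Section Exchange.
Variables (R : realType) (n k r : nat).
Local Notation C := R[i].
Local Notation form := (Defs.form R).
Local Notation S := {mpoly C[n.+1]}.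
Local Notation m := (n + k).+1.
Variable b : n.+1.-tuple (form n).
Hypothesis unit_b : basis_mx b \in unitmx.
Variable f : r.-tuple (form (n + k)).
Variable G : S.
Hypothesis homG : G \is k.+1.-homog.
Hypothesis locG : forall i, colon_radical (wedge_equations b f) G 'X_i.
Implicit Types p q u v g l s ft : {poly C}.
Local Notation val := (value b G).

Lemma valueZ z p : val (z *: p) = z ^+ k.+1 * val p.
Proof.
rewrite /value -(meval_homog z _ homG); apply: meval_eq => i.
by rewrite -[z *: p]addr0 coords_lin /coords linear0 mul0mx addr0 mxE.
Qed.

Lemma value_line p q : exists2 w : {poly C}, (size w <= k.+2)%N &
  forall z, w.[z] = val (p + z *: q).
Proof.
have [w szw wE] := mpoly_line (fun i => coords b p 0 i) (fun i => coords b q 0 i) homG.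
exists w => // z; rewrite wE; apply: meval_eq => i.
by rewrite [p + _]addrC coords_lin !mxE addrC.
Qed.

(** Choose c away from the roots of q, ft, l0 and s: then l0 and both factors
    of s are proportional to forms 1 - a (X - c).  In the coordinates of
    [slice], the line of the multiples of q l0 is the locus where one of the
    variables is beta, and Phi does not vanish at beta because l0 does not
    divide ft. *)
Lemma vanish_on_plane q ft (l0 : {poly C}) (t : 'rV[C]_r) : (size q < n)%N -> (size ft <= k.+3)%N ->
  t != 0 -> rVpoly (t *m form_mx f) = q * ft -> q * ft != 0 ->
  l0 != 0 -> (size l0 <= 2)%N ->
  (forall g, (size g <= k.+2)%N -> ft != l0 * g) ->
  (forall l, (size l <= 2)%N -> val (q * l0 * l) = 0) ->
  forall s, (size s <= 3)%N -> val (q * s) = 0.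
Proof.
move=> szq szft nz_t tE nz_qft nz_l0 szl0 ndvd vanl0 s szs.
case: (eqVneq s 0) => [->|nz_s].
  by have := vanl0 0; rewrite size_poly0 !mulr0; apply.
have nz : q * ft * (l0 * s) != 0 by rewrite mulf_neq0 // mulf_neq0.
have [c] := poly_nonroot nz.
rewrite !hornerM !mulf_eq0 !negb_or => /andP[/andP[nz_q nz_ft] /andP[nz_l0c nz_sc]].
have [a1 [s1 [sE szs1 nz_s1]]] := linear_factor szs nz_sc.
have [a2 [s2 [s1E szs2 nz_s2]]] := linear_factor szs1 nz_s1.
have [beta [l1 [l0E szl1 nz_l1]]] := linear_factor szl0 nz_l0c.
have s2E := size1_polyC szs2; have l1E := size1_polyC szl1.
rewrite {1}l1E hornerC in nz_l1.
have {}l0E : l0 = (1 - beta *: ('X - c%:P)) * (l1`_0)%:P by rewrite -l1E.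
set mu := 'X - c%:P in sE s1E l0E.
have szmu a : (size (1 - a *: mu)%R <= 2)%N.
  rewrite (leq_trans (size_polyD _ _)) // size_poly1 size_polyN geq_max /=.
  by rewrite (leq_trans (size_scale_leq _ _)) // size_XsubC.
pose Gam := slice (fun i => coords b q 0 i) (fun i => coords b (q * mu) 0 i)
  (fun i => coords b (q * mu ^+ 2) 0 i) G.
have GamE x y : Gam.[y%:P].[x] = val (q * (1 - x *: mu) * (1 - y *: mu)).
  rewrite slice_horner; apply: meval_eq => i.
  rewrite expand_quadratic !coords_lin; set X0 := coords b q.
  set X1 := coords b _; set X2 := coords b _.
  by rewrite row_lin3E expand_quadratic_coef.
have Gb x : val (q * (1 - x *: mu) * (1 - beta *: mu)) = 0.
  rewrite (rescale_factor _ _ _ nz_l1) -l0E.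
  by apply: vanl0; rewrite (leq_trans (size_scale_leq _ _)).
have Gam0 : Gam = 0.
  have [u [v uvE]] := slice_local unit_b locG szq szft nz_t tE nz_q.
  apply: (bivariate_vanish (beta := beta) _ _ _ _ _ _ uvE).
  - exact: size_reverse_taylor.
  - apply/negP => /eqP/reverse_taylor_root[//|g ftE szg].
    have /negP[] := ndvd ((l1`_0)^-1 *: g) (leq_trans (size_scale_leq _ _) szg).
    have := rescale_factor 1 (1 - beta *: mu) g nz_l1.
    by rewrite !mul1r -l0E => <-; rewrite ftE mulrC.
  - exact: size_slice.
  - by move=> j; apply: size_slice_coef.
  - by apply: poly_horner_eq0 => x; rewrite GamE Gb.
  have G0 : map_poly (horner_eval beta) Gam = 0.
    apply: poly_horner_eq0 => x.
    have -> : x = horner_eval beta x%:P by rewrite /horner_eval hornerC.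
    by rewrite horner_map /= /horner_eval GamE mulrAC Gb.
  by move=> j; have := congr1 (fun w : {poly C} => w`_j) G0; rewrite coef_map coef0.
have := GamE a1 a2; rewrite Gam0 !horner0 => v0.
by rewrite sE s1E s2E !mulrA mulrC mul_polyC valueZ -v0 mulr0.
Qed.

(** * Exchange of roots *)

Hypothesis free_f : row_free (form_mx f).
Hypothesis r_n : r.+1 = n.

(** The form p of degree n - 1 is such that the line of its multiples does
    not meet the zero scheme of the f_j. *)
Definition transverse p := p != 0 /\
  forall (t : 'rV[C]_r) g, (size g <= k.+2)%N ->
    rVpoly (t *m form_mx f) = p * g -> t = 0.

(** Dimension count: the forms f_j and q x^i span at most n + k + 1
    dimensions, and there are r + (k + 3) > n + k + 1 of them. *)
Lemma exists_multiple q : q != 0 -> (size q < n)%N ->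
  exists (t : 'rV[C]_r) ft, [/\ t != 0, (size ft <= k.+3)%N &
    rVpoly (t *m form_mx f) = q * ft].
Proof.
move=> nz_q szq; pose N := col_mx (form_mx f) (shifts k.+2 m q).
have : kermx N != 0.
  rewrite kermx_eq0 -row_leq_rank -ltnNge (leq_ltn_trans (rank_leq_col _)) //.
  by rewrite -r_n !addnS !addSn.
case/rowV0Pn => w /sub_kermxP; rewrite -[w]hsubmxK mul_row_col.
move: (lsubmx w) (rsubmx w) => t g tg nz_w.
have {tg} tE : t *m form_mx f = poly_rV (q * rVpoly (- g)).
  by rewrite -mul_shifts mulNmx; apply/eqP; rewrite -addr_eq0 tg.
have szg : (size (q * rVpoly (- g))%R <= m)%N.
  apply: leq_trans (size_polyMleq _ _) _; rewrite -subn1 leq_subLR add1n.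
  apply: leq_trans (leq_add (leqnn _) (size_poly _ _)) _.
  by rewrite !addnS !ltnS -addSn leq_add2r.
exists t, (rVpoly (- g)); split; last by rewrite tE poly_rV_K.
  apply: contraNneq nz_w => t0; move: tE; rewrite t0 mul0mx => /(congr1 rVpoly).
  rewrite poly_rV_K // linear0 => /eqP.
  rewrite eq_sym mulf_eq0 (negPf nz_q) /= => /eqP g0.
  by rewrite -[g]opprK -[- g]rVpolyK g0 linear0 oppr0 row_mx0.
exact: size_poly.
Qed.

(** Induction on the number j of factors of u which are exchanged.  Write
    u = l0 u'.  By [vanish_on_plane], G vanishes on the plane of the multiples
    of u' v.  Thus, for almost all rho, the induction hypothesis applies to u'
    and (X - rho) v.  It reaches the other values of rho, and then the factor 1
    which replaces X - rho for the root at infinity, because G is polynomial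
    along lines. *)
Lemma vanish_exchange j u v : (j < n)%N -> (size u <= j.+1)%N -> (size v <= n - j)%N ->
  transverse (u * v) -> (forall l, (size l <= 2)%N -> val (u * v * l) = 0) ->
  forall g, (size g <= j.+2)%N -> val (v * g) = 0.
Proof.
elim: j u v => [|j IHj] u v ltjn szu szv [nz_uv gen_uv] van_uv.
  have uE := size1_polyC szu; have nz_u : u`_0 != 0.
    by apply: contraNneq nz_uv => u0; rewrite uE u0 polyC0 mul0r.
  move=> g szg; have := van_uv ((u`_0)^-1 *: g).
  rewrite (leq_trans (size_scale_leq _ _)) // => /(_ isT).
  have e := rescale_factor 1 v g nz_u; rewrite !mul1r -uE in e.
  by rewrite [u * v]mulrC -e mulrC.
have /norP[nz_u nz_v] : ~~ ((u == 0) || (v == 0)) by rewrite -mulf_eq0.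
have [c nz_uc] := poly_nonroot nz_u.
have [a [u' [uE szu' nz_u'c]]] := linear_factor szu nz_uc.
set l0 := 1 - a *: _ in uE.
have nz_u' : u' != 0 by apply: contraNneq nz_u'c => ->; rewrite horner0.
have nz_l0 : l0 != 0 by apply: contraNneq nz_u => l00; rewrite uE l00 mul0r.
have szl0 : (size l0 <= 2)%N.
  rewrite (leq_trans (size_polyD _ _)) // size_poly1 size_polyN geq_max /=.
  by rewrite (leq_trans (size_scale_leq _ _)) // size_XsubC.
pose q := u' * v.
have uvE : u * v = q * l0 by rewrite uE /q [RHS]mulrC mulrA.
have nz_q : q != 0 by rewrite mulf_neq0.
have szq : (size q < n)%N.
  rewrite size_mul //; apply: leq_ltn_trans (_ : (j.+1 + (n - j.+1)).-1 < n)%N.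
    by rewrite -!subn1 leq_sub2r // leq_add.
  by rewrite subnKC ?ltn_predL ?(leq_ltn_trans _ ltjn) // ltnW.
have [t [ft [nz_t szft tE]]] := exists_multiple nz_q szq.
have nz_qft : q * ft != 0.
  apply: contraNneq nz_t => qft0; have := congr1 (@poly_rV C m) tE.
  by rewrite rVpolyK qft0 linear0 => /eqP; rewrite mulmx_free_eq0.
have nz_ft : ft != 0 by apply: contraNneq nz_qft => ->; rewrite mulr0.
have ndvd g : (size g <= k.+2)%N -> ft != l0 * g.
  move=> szg; apply: contraNneq nz_t => ftE; apply/eqP.
  by apply: (gen_uv t g szg); rewrite tE ftE uvE mulrA.
have van_q : forall s, (size s <= 3)%N -> val (q * s) = 0.
  apply: (vanish_on_plane szq szft nz_t tE nz_qft nz_l0 szl0 ndvd) => l szl.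
  by rewrite -uvE; apply: van_uv.
pose Phi p := (reverse_taylor c k.+2 p).[a].
have nz_Phi : Phi ft != 0.
  apply/negP => /eqP/reverse_taylor_root[//|g ftE szg].
  by have /eqP := ndvd g szg.
have van1 rho g : ft.[rho] != 0 -> (size g <= j.+2)%N -> val (('X - rho%:P) * v * g) = 0.
  move=> nz_rho szg.
  have szrho p e : (size p <= e)%N -> (size (('X - rho%:P) * p)%R <= e.+1)%N.
    move=> szp; apply: leq_trans (size_polyMleq _ _) _.
    by rewrite size_XsubC add2n /= ltnS.
  have szrv : (size (('X - rho%:P) * v)%R <= n - j)%N.
    by rewrite -(subnSK (ltnW ltjn)); apply: szrho.
  apply: (IHj u' (('X - rho%:P) * v) (ltnW ltjn) szu' szrv _ _ g szg).
  - split.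
      by rewrite mulf_neq0 // mulf_neq0 // polyXsubC_eq0.
    move=> t' g' szg' t'E.
    pose e := ('X - rho%:P) * g'.
    have t'E2 : rVpoly (t' *m form_mx f) = q * e.
      by rewrite t'E /q /e; ring.
    have sze : (size e <= k.+3)%N.
      exact: szrho.
    pose tau := Phi e / Phi ft.
    have : Phi (- tau *: ft + e) = 0.
      rewrite /Phi reverse_taylor_lin hornerD hornerZ -/(Phi _) -/(Phi _).
      by rewrite mulNr divfK // addNr.
    move=> /reverse_taylor_root[|g2 g2E szg2].
      rewrite (leq_trans (size_polyD _ _)) // geq_max sze andbT.
      by rewrite (leq_trans (size_scale_leq _ _)).
    have tt' : - tau *: t + t' = 0.
      apply: (gen_uv _ g2 szg2).
      have -> : u * v * g2 = q * (- tau *: ft + e) by rewrite uvE g2E mulrA.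
      rewrite mulmxDl -scalemxAl linearP /= tE t'E2.
      by rewrite mulrDr -scalerAr.
    have etau : e = tau *: ft.
      apply: (mulfI nz_q); rewrite -t'E2 -scalerAr -tE -linearZ scalemxAl.
      by congr (rVpoly (_ *m _)); apply/eqP; rewrite -subr_eq0 addrC -scaleNr tt'.
    have tau0 : tau = 0.
      have /eqP := congr1 (horner^~ rho) etau.
      rewrite hornerM hornerXsubC subrr mul0r hornerZ eq_sym mulf_eq0.
      by rewrite (negPf nz_rho) orbF => /eqP.
    by move: tt'; rewrite tau0 oppr0 scale0r add0r.
  move=> l szl; have -> : u' * (('X - rho%:P) * v) * l = q * (('X - rho%:P) * l).
    by rewrite /q; ring.
  by apply: van_q; apply: szrho.
have van2 rho g : (size g <= j.+2)%N -> val (('X - rho%:P) * v * g) = 0.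
  move=> szg; have [w _ wE] := value_line ('X * v * g) (- (v * g)).
  have E z : ('X - z%:P) * v * g = 'X * v * g + z *: - (v * g).
    by rewrite -mul_polyC; ring.
  rewrite E -wE (_ : w = 0) ?horner0 //; apply: (poly_horner_ext nz_ft) => x nz_x.
  by rewrite horner0 wE -E van1.
have van3 g : (size g <= j.+2)%N -> val (v * g) = 0.
  move=> szg; have [w _ wE] := value_line (v * g) (- ('X * v * g)).
  have := wE 0; rewrite scale0r addr0 => <-; rewrite (_ : w = 0) ?horner0 //.
  apply: (@poly_horner_ext _ _ _ 'X); rewrite ?polyX_eq0 // => x.
  rewrite hornerX horner0 wE => nz_x.
  have -> : v * g + x *: - ('X * v * g) = (- x) *: (('X - x^-1%:P) * v * g).
    by rewrite -!mulrA line_at_infinity.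
  by rewrite valueZ van2 ?mulr0.
move=> g szg; case: (leqP (size g) j.+2) => [/van3 //|lt_g].
have /closed_rootP[z /factor_theorem[g' gE]] : size g != 1%N.
  by rewrite gtn_eqF // (leq_ltn_trans _ lt_g).
rewrite gE mulrCA mulrC [v * _]mulrC; apply: van2.
rewrite -ltnS; apply: leq_trans szg; rewrite gE size_Mmonic ?monicXsubC ?size_XsubC ?addn2 //.
by apply: contraTneq lt_g => g'0; rewrite gE g'0 mul0r size_poly0.
Qed.

Lemma eq0_of_vanish_on_line p : (size p <= n)%N -> transverse p ->
  (forall z, val (('X - z%:P) * p) = 0) -> G = 0.
Proof.
move=> szp gen_p van; apply: mpoly_vanish => x.
have -> : G.@[x] = val (point_form b (\row_i x i)).
  by apply: meval_eq => i; rewrite point_formK // mxE.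
have van_p : val p = 0.
  have [w _ wE] := value_line p (- ('X * p)).
  have := wE 0; rewrite scale0r addr0 => <-; rewrite (_ : w = 0) ?horner0 //.
  apply: (@poly_horner_ext _ _ _ 'X); rewrite ?polyX_eq0 // => y.
  by rewrite hornerX horner0 wE => nz_y; rewrite line_at_infinity // valueZ van mulr0.
rewrite -[point_form _ _]mul1r; apply: (@vanish_exchange r p 1).
- by rewrite r_n.
- by rewrite r_n.
- by rewrite size_poly1 subn_gt0 r_n.
- by rewrite mulr1.
- move=> l szl; rewrite mulr1; case: (leqP (size l) 1) => [/size1_polyC ->|lt_l].
    by rewrite mulrC mul_polyC valueZ van_p mulr0.
  have /closed_rootP[z /factor_theorem[l' lE]] : size l != 1%N by rewrite gtn_eqF.
  have /size1_polyC l'E : (size l' <= 1)%N.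
    have nz_l' : l' != 0 by apply: contraTneq lt_l => l'0; rewrite lE l'0 mul0r size_poly0.
    by move: szl; rewrite lE size_Mmonic ?monicXsubC // size_XsubC addn2.
  by rewrite mulrC lE -mulrA l'E mul_polyC valueZ van mulr0.
by rewrite r_n size_point_form.
Qed.

End Exchange.

(** * The last section *)

Section Laplace.
Variables (R : realType) (n k r : nat).
Local Notation C := R[i].
Local Notation form := (Defs.form R).
Variables (b : n.+1.-tuple (form n)) (f0 : form (n + k)) (f : r.-tuple (form (n + k))).

Lemma wedge_cons p : wedge_equations b (cons_tuple f0 f) p ->
  in_ideal (wedge_equations b f) p.
Proof.
move=> [d [w [dw ->]]]; rewrite (expand_det_col _ ord0).
apply: in_ideal_sum => i; rewrite /cofactor mulrA; apply: in_ideal_gen.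
exists (fun j => d (lift i j)), (fun j => w (lift i j)); split=> [j|]; first exact: dw.
by congr (\det _); apply/matrixP => j l; rewrite !mxE tnthS.
Qed.

Lemma subscheme_cons :
  subscheme (wedge_zero_scheme b f) (wedge_zero_scheme b (cons_tuple f0 f)).
Proof. by move=> p wp i; exists 0%N; apply/in_idealM/wedge_cons. Qed.

End Laplace.

Section Completion.
Variables (R : realType) (k r : nat).
Local Notation C := R[i].
Local Notation form := (Defs.form R).
Local Notation n := r.+1.
Local Notation S := {mpoly C[n.+1]}.
Local Notation m := (n + k).+1.
Local Notation dim := (@poncelet_dim n k).
Variable b : n.+1.-tuple (form n).
Hypothesis unit_b : basis_mx b \in unitmx.
Variable f : r.-tuple (form (n + k)).
Hypothesis free_f : row_free (form_mx f).

Definition poncelet_eq (F : 'M[C]_(n, m)) : S := \det (poncelet_mx b F).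

Definition adjoin_row (w : 'rV[C]_m) : 'M[C]_(n, m) := (col_mx w (form_mx f) : 'M_(1 + r, m)).

Lemma form_mx_cons f0 :
  form_mx (cons_tuple f0 f) = adjoin_row (poly_rV (dehom f0)).
Proof.
apply/matrixP => i j; rewrite mxE /adjoin_row.
case: (split_ordP (i : 'I_(1 + r))) => i' ->.
  by rewrite (col_mxEu (_ : 'rV_m)) [i']ord1 mxE.
rewrite (col_mxEd (_ : 'rV_m)) mxE; congr (dehom _)`_j.
have -> : rshift 1 i' = lift ord0 i' by apply: val_inj.
by rewrite tnthS.
Qed.

Lemma value_poncelet F (p : {poly C}) : (size p <= n.+1)%N ->
  value b (poncelet_eq F) p = \det (stack dim (shifts k m p) F).
Proof.
move=> szp; rewrite /value /poncelet_eq; set x := coords b p.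
pose ev : {rmorphism S -> C} := meval (fun i => x 0 i).
rewrite -[LHS]/(ev _) -det_map_mx /poncelet_mx map_stack map_shifts_tautological coordsK //.
by congr (\det (stack _ _ _)); apply/matrixP => i j; rewrite !mxE; apply: mevalC.
Qed.

Lemma poncelet_eq_homog F : poncelet_eq F \is k.+1.-homog.
Proof. exact: poncelet_hypersurface_homog. Qed.

Lemma poncelet_eq_free F : poncelet_eq F != 0 -> row_free F.
Proof.
apply: contraNT => nfree.
have /rowV0Pn[t /sub_kermxP tF nz_t] : kermx F != 0 by rewrite kermx_eq0.
apply/eqP/mpoly_vanish => x.
have -> : (poncelet_eq F).@[x] = value b (poncelet_eq F) (point_form b (\row_i x i)).
  by apply: meval_eq => i; rewrite point_formK // mxE.
rewrite value_poncelet ?size_point_form //; apply/det_stack_eq0; exists 0, t.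
by rewrite nz_t orbT mul0mx tF addr0.
Qed.

Variables (F : S) (p0 : {poly C}).
Hypothesis homF : F \is k.+1.-homog.
Hypothesis locF : forall i, colon_radical (wedge_equations b f) F 'X_i.
Hypothesis szp0 : (size p0 <= n)%N.
Hypothesis transverse_p0 : transverse f p0.

(** Let delta z w be the value at p0 (X - z) of the equation given by the
    sections w and f_j.  It is 0 when w is a multiple of p0 (X - z), so that
    delta z (p0 e) = e(z) (delta z p0).  As p0 is transverse, the polynomial
    delta z p0 in z has no root, hence it is a constant c.  Choose e such that
    c e(z) is the value of F at p0 (X - z).  Then f0 = p0 e works: the
    difference of both equations vanishes on the line. *)
Lemma poncelet_completion : exists f0, F = poncelet_eq (form_mx (cons_tuple f0 f)).
Proof.
have [nz_p0 gen0] := transverse_p0.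
pose L z := ('X - z%:P) * p0.
have LE z : L z = 'X * p0 + z *: - p0 by rewrite /L mulrBl scalerN -mul_polyC.
have szL z : (size (L z) <= n.+1)%N.
  by rewrite /L mulrC size_Mmonic ?monicXsubC // size_XsubC addn2.
pose delta z (w : {poly C}) :=
  \det (stack dim (shifts k m (L z)) (adjoin_row (poly_rV w))).
have sz_mul (w : {poly C}) : (size w <= k.+2)%N -> (size (p0 * w)%R <= m)%N.
  move=> szw; apply: leq_trans (size_polyMleq _ _) _; rewrite -subn1 leq_subLR add1n.
  by apply: leq_trans (leq_add szp0 szw) _; rewrite !addnS.
have deltaD z x (w w' : {poly C}) : delta z (x *: w + w') = x * delta z w + delta z w'.
  by rewrite /delta linearP; apply: det_stack_linear.
have delta0 z (g : {poly C}) : (size g <= k.+1)%N -> delta z (L z * g) = 0.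
  move=> szg; apply/det_stack_cons_eq0.
  exists (poly_rV g), (-1), 0; split; first by rewrite oppr_eq0 oner_eq0 orbT.
  by rewrite mul_shifts poly_rV_K // scaleN1r subrr mul0mx addr0.
have [kap _ kapE] : exists2 kap : {poly C}, (size kap <= k.+2)%N & forall z, kap.[z] = delta z p0.
  have [w szw wE] := value_line b (poncelet_eq_homog (adjoin_row (poly_rV p0))) ('X * p0) (- p0).
  by exists w => // z; rewrite wE -LE value_poncelet.
have nz_delta z : delta z p0 != 0.
  apply/negP => /eqP/det_stack_cons_eq0[g [x [t [nz]]]].
  rewrite mul_shifts => gxt0.
  pose gam := - (('X - z%:P) * rVpoly g + x%:P).
  have szgam : (size gam <= k.+2)%N.
    rewrite size_polyN (leq_trans (size_polyD _ _)) // geq_max.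
    rewrite (leq_trans (size_polyC_leq1 _)) // andbT.
    apply: leq_trans (size_polyMleq _ _) _; rewrite size_XsubC add2n /= ltnS.
    exact: size_poly.
  have tE : rVpoly (t *m form_mx f) = p0 * gam.
    rewrite -[RHS](poly_rV_K (sz_mul _ szgam)); congr rVpoly.
    apply: (addrI (poly_rV (L z * rVpoly g) + x *: poly_rV p0)); rewrite gxt0.
    rewrite -!linearZ -!linearD /= (_ : _ + _ = 0) ?linear0 //.
    by rewrite /gam /L -mul_polyC mulrN mulrDr mulrA [p0 * _]mulrC [p0 * x%:P]mulrC subrr.
  have t0 : t = 0 by apply: gen0 szgam tE.
  have gam0 : ('X - z%:P) * rVpoly g + x%:P = 0.
    move: tE; rewrite t0 mul0mx linear0 => /esym/eqP.
    by rewrite mulf_eq0 (negPf nz_p0) oppr_eq0 => /eqP.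
  have x0 : x = 0.
    have := congr1 (horner^~ z) gam0.
    by rewrite hornerD hornerM hornerXsubC subrr mul0r add0r hornerC horner0.
  move: gam0; rewrite x0 addr0 => /eqP; rewrite mulf_eq0 polyXsubC_eq0 /= => /eqP g0.
  by move: nz; rewrite x0 t0 -[g]rVpolyK g0 linear0 !eqxx.
have [c kapc] : exists c, kap = c%:P.
  have /size_poly1P[c _ ->] : size kap == 1%N; last by exists c.
  apply/negPn/negP => /closed_rootP[z /rootP]; rewrite kapE => /eqP.
  by rewrite (negPf (nz_delta z)).
have deltac z : delta z p0 = c by rewrite -kapE kapc hornerC.
have nz_c : c != 0 by rewrite -(deltac 0).
have [phi szphi phiE] := value_line b homF ('X * p0) (- p0).
pose e := c^-1 *: phi.
have sze : (size e <= k.+2)%N by rewrite (leq_trans (size_scale_leq _ _)).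
pose f0 := homogenize (n + k) (p0 * e).
have f0E : dehom f0 = p0 * e by rewrite homogenizeK ?sz_mul.
exists f0; apply/eqP; rewrite -subr_eq0; apply/eqP.
set D := poncelet_eq _; have homD : D \is k.+1.-homog by apply: poncelet_eq_homog.
have homFD : F - D \is k.+1.-homog by apply: rpredB.
apply: (eq0_of_vanish_on_line unit_b homFD _ free_f erefl szp0 transverse_p0) => [i|z].
 have [N1 FN] := locF i.
  have [_ WD] := wedge_hypersurface unit_b (cons_tuple f0 f).
  have [N2 DN] := subscheme_trans (@subscheme_cons _ _ _ _ b f0 f) WD erefl i.
  exists (N1 + N2)%N; rewrite mulrBr; apply: in_idealD.
    by rewrite addnC exprD -mulrA; apply: in_idealM.
  by rewrite -mulN1r exprD -mulrA; do 2!apply: in_idealM.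
rewrite -/(L z) /value mevalB -/(value b F (L z)) -/(value b D (L z)).
rewrite {1}LE -phiE value_poncelet // form_mx_cons.
rewrite f0E -/(delta z _).
have [e1 e1E] : exists e1, e = e1 * ('X - z%:P) + (e.[z])%:P.
  have /factor_theorem[e1 e1E] : root (e - (e.[z])%:P) z.
    by rewrite rootE !hornerE subrr.
  by exists e1; rewrite -e1E subrK.
have sze1 : (size e1 <= k.+1)%N.
  case: (eqVneq e1 0) => [->|nz_e1]; first by rewrite size_poly0.
  have : (size (e - (e.[z])%:P)%R <= k.+2)%N.
    rewrite (leq_trans (size_polyD _ _)) // size_polyN geq_max sze /=.
    exact: leq_trans (size_polyC_leq1 _) _.
  by rewrite {1}e1E addrK size_Mmonic ?monicXsubC // size_XsubC addn2.
have -> : p0 * e = e.[z] *: p0 + L z * e1.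
  by rewrite {1}e1E /L -mul_polyC mulrDr addrC mulrC [e1 * _]mulrC
    mulrCA [p0 * e1]mulrC mulrA mulrAC.
by rewrite deltaD delta0 // addr0 deltac /e hornerZ mulrAC mulVf // mul1r subrr.
Qed.

End Completion.

(** * The characterization of Poncelet hypersurfaces *)

Section Characterization.
Variables (R : realType) (r k : nat).
Local Notation C := R[i].
Local Notation form := (Defs.form R).
Local Notation n := r.+1.

Lemma basis_unit (b : n.+1.-tuple (form n)) : basis_of fullv b -> basis_mx b \in unitmx.
Proof. by move=> /basis_free; rewrite free_dehom row_free_unit. Qed.

Lemma exists_transverse (f : r.-tuple (form (n + k))) : row_free (form_mx f) ->
  exists2 p : {poly C}, (size p <= n)%N & transverse f p.
Proof.
move=> /general_points[z unit_fz].
exists (\prod_(i < r) ('X - (z i)%:P)).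
  by rewrite -big_enum size_prod_XsubC size_enum_ord.
split; first by apply/prodf_neq0 => i _; rewrite polyXsubC_eq0.
move=> t g _ tE; apply/eqP; rewrite -(mulmx1 t) -(mulmxV unit_fz) 2!mulmxA.
suff -> : t *m form_mx f *m \matrix_(l, i) z i ^+ l = 0 by rewrite mul0mx.
apply/rowP => i; rewrite [RHS]mxE.
transitivity ((t *m form_mx f *m powers (n + k).+1 (z i)) 0 0).
  by rewrite [LHS]mxE [RHS]mxE; apply: eq_bigr => l _; rewrite !mxE.
by rewrite mul_powers tE hornerM horner_prod (bigD1 i) //= hornerXsubC subrr !mul0r mxE.
Qed.

Lemma hypersurface_degree d e (F G : {mpoly C[n.+1]}) (homF : F \is d.-homog)
    (homG : G \is e.-homog) : F != 0 ->
  same_subscheme (hypersurface homF) (hypersurface homG) -> d = e.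
Proof.
move=> nz_F [FG GF].
have [q qE] := dvd_hypersurface (ltn0Sn r) FG; have [q' q'E] := dvd_hypersurface (ltn0Sn r) GF.
have nz_G : G != 0 by apply: contraNneq nz_F => G0; rewrite q'E G0 mulr0.
have degE c (P : {mpoly C[n.+1]}) : P != 0 -> P \is c.-homog -> (c = (msize P).-1)%N.
  by move=> nz_P homP; apply: (dhomog_uniq nz_P homP); apply: (dhomog_msize homP).
have le_sz (P Q q0 : {mpoly C[n.+1]}) : Q != 0 -> Q = q0 * P -> (msize P <= msize Q)%N.
  move=> nz_Q QE; have nz_q0 : q0 != 0 by apply: contraNneq nz_Q => q00; rewrite QE q00 mul0r.
  have nz_P : P != 0 by apply: contraNneq nz_Q => P0; rewrite QE P0 mulr0.
  rewrite QE msizeM // -subn1 leq_subRL ?addn_gt0 ?lt0n ?msize_poly_eq0 ?nz_P ?nz_q0 //.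
  by rewrite leq_add2r lt0n msize_poly_eq0.
rewrite (degE _ _ nz_F homF) (degE _ _ nz_G homG); congr _.-1.
by apply/eqP; rewrite eqn_leq (le_sz F G q) // (le_sz G F q').
Qed.

End Characterization.

Theorem proposition1 (R : realType) (n k : nat) (hn : (2 <= n)%N)
    (F : {mpoly R[i][n.+1]}) (F_neq0 : F != 0) (homF : F \is k.+1.-homog) :
  poncelet_hypersurface (hypersurface homF) <->
  exists Z : closed_subscheme R n,
    [/\ poncelet_variety k n.-1 Z,
        has_codim Z 2 &
        subscheme Z (hypersurface homF)].
Proof.
case: n hn F F_neq0 homF => // r _ F F_neq0 homF; rewrite -[r.+1.-1]/r; split.
  move=> [k' [b [f [b_basis free_f FW]]]].
  have unit_b := basis_unit b_basis.
  have FD := same_subscheme_trans FW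
    (same_subscheme_sym (wedge_hypersurface unit_b f)).
  have k_k' : k = k' by apply: succn_inj; apply: hypersurface_degree F_neq0 FD.
  case: _ / k_k' in f free_f FW {FD} *.
  case/tupleP: f free_f FW => f0 f free_f FW.
  have {}free_f : free f by move: free_f; rewrite free_cons => /andP[].
  exists (wedge_zero_scheme b f); split.
  - by exists b, f; split=> //; split; apply: subscheme_refl.
  - exact: wedge_codim2.
  by case: FW => _ WF; apply: subscheme_trans (@subscheme_cons _ _ _ _ b f0 f) WF.
move=> [Z [[b [f [b_basis free_f [_ WZ]]]] _ ZF]]; exists k.
have unit_b := basis_unit b_basis.
have row_free_f : row_free (form_mx f) := etrans (esym (free_dehom f)) free_f.
have locF i := subscheme_trans WZ ZF erefl i.
have [p szp gen_p] := exists_transverse row_free_f.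
have [f0 FE] := poncelet_completion unit_b row_free_f homF locF szp gen_p.
exists b, (cons_tuple f0 f); split=> //.
  rewrite free_dehom; apply: (poncelet_eq_free unit_b).
  by rewrite -/(form_mx _) -FE.
apply: same_subscheme_trans (wedge_hypersurface unit_b (cons_tuple f0 f)).
by split=> _ -> i; exists 0%N; apply: in_ideal_gen.
Qed.
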